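(* Let $G$ be a pentagraph. Then at least one of the following holds: (1) $G$ is bipartite; (2) $G$ is isomorphic to the Petersen graph; (3) $G$ has a vertex of degree at most two; (4) $G$ admits a $P_3$-cutset or a strong parity star-cutset.
   Context: All graphs are finite, with no loops or parallel edges. A graph $G$ is a pentagraph if every cycle of $G$ has length at least five, and every induced cycle of $G$ of odd length has length exactly five. The length of a path is its number of edges, and the interior of a path is its set of internal (non-end) vertices. For $X\subseteq V(G)$, $G\setminus X$ is the graph obtained from $G$ by deleting $X$. A $P_3$-cutset of $G$ is an induced three-vertex path $P$ of $G$ such that $G\setminus V(P)$ is disconnected. A parity star-cutset of $G$ is a set $X\subseteq V(G)$ such that $G\setminus X$ is disconnected, there is a vertex $x\in X$ adjacent to every other vertex in $X$, and there is a component $A$ of $G\setminus X$ such that every two (distinct) vertices in $X\setminus\{x\}$ are joined by an induced path of $G$ of even length with interior in $V(A)$. It is a strong parity star-cutset if $A$ can be chosen such that in addition $x$ has a neighbour in $V(A)$. *)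

(* Defs.v *)
From mathcomp Require Import all_boot.

Set Implicit Arguments.
Unset Strict Implicit.
Unset Printing Implicit Defensive.

Record sgraph : Type := SGraph {
  vertex :> finType;
  adj : rel vertex;
  adj_sym : symmetric adj;
  adj_irr : irreflexive adj }.

Definition degree (G : sgraph) (v : G) : nat := #|[set w | adj v w]|.

Definition bipartite (G : sgraph) : Prop :=
  exists f : G -> bool, forall u v : G, adj u v -> f u != f v.

Definition isomorphic (G H : sgraph) : Prop :=
  exists2 f : G -> H, bijective f & forall u v : G, adj (f u) (f v) = adj u v.

(* A cycle is the cyclic sequence of its vertices, so its length is the [size]
   of the sequence. *)
Definition is_cycle (G : sgraph) (c : seq G) : bool :=
  [&& 3 <= size c, uniq c & cycle (@adj G) c].

Definition induced_cycle (G : sgraph) (c : seq G) : Prop :=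
  is_cycle c /\
  {in c &, forall u v, adj u v -> v = next c u \/ u = next c v}.

Definition pentagraph (G : sgraph) : Prop :=
  (forall c : seq G, is_cycle c -> 5 <= size c) /\
  (forall c : seq G, induced_cycle c -> odd (size c) -> size c = 5).

(* A path is the sequence of its vertices, so its length is [(size p).-1]. *)
Definition is_path (G : sgraph) (p : seq G) : bool :=
  [&& 0 < size p, uniq p & sorted (@adj G) p].

Definition induced_path (G : sgraph) (p : seq G) : Prop :=
  is_path p /\
  {in p &, forall u v, adj u v ->
    index v p = (index u p).+1 \/ index u p = (index v p).+1}.

(* Adjacency in the graph obtained by deleting X.  The vertices of X stay in
   the carrier, so the notions below quantify over vertices outside X only. *)
Definition del_adj (G : sgraph) (X : {set G}) : rel G :=
  [rel u v | [&& u \notin X, v \notin X & adj u v]].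

Definition del_disconnected (G : sgraph) (X : {set G}) : Prop :=
  exists u v : G, [/\ u \notin X, v \notin X & ~~ connect (del_adj X) u v].

(* A is the vertex set of a component of the graph obtained by deleting X. *)
Definition del_component (G : sgraph) (X A : {set G}) : Prop :=
  exists2 u : G, u \notin X & A = [set v | connect (del_adj X) u v].

Definition P3_cutset (G : sgraph) (p : seq G) : Prop :=
  [/\ induced_path p, size p = 3 & del_disconnected [set v in p]].

(* The path a :: rcons q b has interior q and length (size q).+1. *)
Definition even_joined (G : sgraph) (A : {set G}) (a b : G) : Prop :=
  exists q : seq G, [/\ induced_path (a :: rcons q b),
    ~~ odd (size q).+1 & {subset q <= A}].

(* X is a parity star-cutset, witnessed by the vertex x and the component A. *)
Definition parity_star_witness (G : sgraph) (X : {set G}) (x : G)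
    (A : {set G}) : Prop :=
  [/\ del_disconnected X,
      x \in X /\ {in X :\ x, forall y, adj x y},
      del_component X A
    & {in X :\ x &, forall a b, a != b -> even_joined A a b}].

Definition strong_parity_star_cutset (G : sgraph) (X : {set G}) : Prop :=
  exists (x : G) (A : {set G}),
    parity_star_witness X x A /\ exists2 y, y \in A & adj x y.

(* The Petersen graph: 2-subsets of a 5-set, adjacent when disjoint. *)
Definition pair5 : finType := {S : {set 'I_5} | #|S| == 2}.

Definition petersen_adj : rel pair5 :=
  fun S T => [disjoint val S & val T].

Lemma petersen_adj_sym : symmetric petersen_adj.
Proof. by move=> S T; rewrite /petersen_adj /= disjoint_sym. Qed.

Lemma petersen_adj_irr : irreflexive petersen_adj.
Proof.
move=> S; rewrite /petersen_adj /= -setI_eq0 setIid -cards_eq0.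
by rewrite (eqP (valP S)).
Qed.

Definition petersen : sgraph := SGraph petersen_adj_sym petersen_adj_irr.

(* Main.v *)
Require Import Defs.
From mathcomp Require Import all_boot.
From Stdlib Require Import Classical.

(** Assume that all degrees are at least three and that there is no P3-cutset.

    If [G] contains the Petersen graph minus a vertex, then any two nonadjacent
    vertices of it (and of the Petersen graph minus at most one edge) are joined by
    induced paths of lengths of both parities, so a component of the rest attaches
    only to an edge, which lies in a P3-cutset, or supplies the missing vertex.

    Otherwise call [(x, W)] good if [W] is a component of [G \ N[x]] not attached to
    all of [N(x)].  Two paths between the same two neighbours of [x], one through
    [W] and one avoiding it, close up to an even hole; so if there is no strong
    parity star-cutset, two neighbours of [x] are joined by a path of length three
    in [W], which gives a 5-hole [x a p q b] with [p] and [q] in [W].  The heart of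
    the proof is a descent: from a 5-hole [C] and a component [D] of [G \ N[C]] one
    finds a good pair inside any region that separates [D] from the rest (up to the
    neighbours of three consecutive vertices of [C]).  Applied to [x a p q b] it
    yields a good pair inside [W], so there is no good pair at all; applied to an
    arbitrary 5-hole it yields a good pair.  Hence there is no 5-hole, and [G] is
    bipartite. *)

Set Implicit Arguments.
Unset Strict Implicit.
Unset Printing Implicit Defensive.

Local Notation "x -- y" := (@adj _ x y) (at level 30).

(** * Chordless paths and holes *)

(** Girth five gives each vertex of [N(C)] outside a 5-hole [C] exactly one neighbour on [C], so
    these vertices fall into five classes. Two classes at distance two are joined around [C] by arcs
    with three and with four vertices; whichever parity a path through a far component [D] has, one
    arc closes it to a forbidden odd hole, so members of such classes on the boundary of [D] are
    adjacent. Without P3-cutsets and without the Petersen graph minus a vertex this leaves two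
    types: the classes met by the boundary of [D] lie in an edge of [C], or in a three-vertex path
    of [C] with both ends met. A change of 5-hole can turn one type into the other, hence a
    simultaneous induction on size. In the edge type the new far component may leave [D], so that
    half is stated for a region [Om] around [D].

    Degree three always enters in the same way: a vertex attached to a 5-hole either has a neighbour
    far from it, where the descent continues, or has neighbours in both opposite classes. The latter
    yields a triangle, a path of the missing parity or, at the end, the Petersen graph minus a
    vertex. *)

Lemma connect_invariant (T : finType) (e : rel T) (S : T -> Prop) (x y : T) :
  (forall v w, S v -> e v w -> S w) -> S x -> connect e x y -> S y.
Proof.
move=> hS Sx /connectP [p]; elim: p x Sx => [|w p IH] x Sx /=.
  by move=> _ ->.
by case/andP=> xw pw ey; apply: (IH w) => //; apply: (hS x).
Qed.

(** A boolean recursive form of induced paths: on an explicit list of vertices it reduces to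
    adjacencies that [rewrite] can settle. The empty list is allowed. *)
Fixpoint chordless (G : sgraph) (p : seq G) : bool :=
  if p is x :: p' then
    (if p' is y :: s then
       [&& adj x y, x \notin p', all (fun z => ~~ adj x z) s & chordless p']
     else true)
  else true.

Section Chordless.

Variable G : sgraph.
Implicit Types (a b c d x y z u v w : G) (p q r s : seq G) (X D W : {set G}).

Lemma adjC x y : x -- y = y -- x.
Proof. exact: adj_sym. Qed.

Lemma adj_neq x y : x -- y -> x != y.
Proof. by move=> h; apply/eqP=> e; rewrite e adj_irr in h. Qed.

Lemma chordless_cons x y s :
  chordless (x :: y :: s) =
  [&& x -- y, x \notin y :: s, all (fun z => ~~ x -- z) s & chordless (y :: s)].
Proof. by []. Qed.

Lemma chordless_behead x p : chordless (x :: p) -> chordless p.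
Proof. by case: p => [|y s] //= /and4P[]. Qed.

Lemma chordless_uniq p : chordless p -> uniq p.
Proof.
elim: p => [|x [|y s] IH] //; rewrite chordless_cons => /and4P[_ xys _ h].
by rewrite cons_uniq xys IH.
Qed.

Lemma chordless_path x p : chordless (x :: p) -> path (@adj G) x p.
Proof.
elim: p x => [|y s IH] x //; rewrite chordless_cons => /and4P[xy _ _ h] /=.
by rewrite xy IH.
Qed.

Lemma chordless_rcons s y x :
  chordless (rcons s y) -> y -- x -> x \notin rcons s y ->
  all (fun z => ~~ z -- x) s -> chordless (rcons (rcons s y) x).
Proof.
elim: s => [|a s IH]; first by move=> _ /= yx; rewrite yx /= !inE eq_sym => ->.
have -> b : rcons (a :: s) b = a :: rcons s b by [].
rewrite rcons_cons inE negb_or => h yx /andP[xa xs] /= /andP[ax sx].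
have hs := IH (chordless_behead h) yx xs sx.
case: s h xs sx hs {IH} => [|b s] h xs sx hs.
  have ay : a -- y by move: h; rewrite /= => /andP[].
  by rewrite /= ay ax yx !inE negb_or (adj_neq ay) [a == x]eq_sym xa /= (adj_neq yx).
move: h; rewrite !rcons_cons !chordless_cons => /and4P[ab anot alls _].
rewrite ab -!rcons_cons hs andbT /=.
rewrite -rcons_cons -rcons_cons mem_rcons inE negb_or eq_sym xa /= anot.
by rewrite all_rcons ax alls.
Qed.

Lemma chordless_rev p : chordless p -> chordless (rev p).
Proof.
elim: p => [|x [|y s] IH] //; rewrite chordless_cons => /and4P[xy xn xs h].
move: (IH h); rewrite !rev_cons => h'.
apply: chordless_rcons => //.
- by rewrite adjC.
- by rewrite -rev_cons mem_rev.
by rewrite all_rev; apply: sub_all xs => z; rewrite adjC.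
Qed.

(** The tail is shortened first; then [x] jumps directly to the last vertex of the result that is
    equal or adjacent to it. *)
Lemma path_chordless x p : path (@adj G) x p ->
  exists2 p', chordless (x :: p') & last x p' = last x p /\ {subset p' <= p}.
Proof.
elim: p x => [|y p IH] x; first by exists [::].
move=> /= /andP[xy /IH [p' h [hl hs]]].
pose P z := (z == x) || x -- z.
have hP : has P (y :: p') by rewrite /= /P xy orbT.
have: exists p1 z p2, [/\ y :: p' = p1 ++ z :: p2, P z & ~~ has P p2].
  elim: (y :: p') hP => [|a t IHt] //=.
  case ht: (has P t).
    by move=> _; case: (IHt ht) => p1 [z [p2 [-> ? ?]]]; exists (a :: p1), z, p2.
  by rewrite orbF => Pa; exists [::], a, t; rewrite ht.
case=> p1 [z [p2 [e Pz hp2]]].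
have hz : chordless (z :: p2).
  move: h; rewrite e; elim: p1 {e} => [|a p1 IHp] //= h.
  by apply: IHp; move: h; case: (p1 ++ z :: p2) => [|b t] // /and4P[].
have lz : last z p2 = last y p by rewrite -hl -[last y p'](last_cons x) e last_cat.
have sz : {subset z :: p2 <= y :: p}.
  move=> t tz; have: t \in y :: p' by rewrite e mem_cat tz orbT.
  by rewrite !inE => /orP[->//|/hs->]; rewrite orbT.
case/orP: Pz => [/eqP zx | xz].
  subst z; case: p2 hp2 hz lz sz {e} => [|b t] hp2 hz lz sz.
    by exists [::].
  by move: hp2 hz; rewrite /= /P => /norP[/norP[_ /negP xb] _] /and4P[].
exists (z :: p2); last by split.
rewrite xz hz andbT inE negb_or (adj_neq xz) /=.
rewrite -all_predC in hp2; apply/andP; split.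
  by apply/negP=> /(allP hp2); rewrite /= /P eqxx.
by apply: sub_all hp2 => t /norP[].
Qed.

Definition conn D := {in D &, forall a b,
  connect (fun a b => [&& a \in D, b \in D & a -- b]) a b}.

Definition touches D v := [exists w in D, v -- w].

Lemma touchesP D v : reflect (exists2 w, w \in D & v -- w) (touches D v).
Proof. exact: 'exists_in_idP. Qed.

Lemma conn_chordless D u v : conn D -> touches D u -> touches D v ->
  u != v -> ~~ u -- v ->
  exists q, [/\ chordless (u :: rcons q v), q != [::] & {subset q <= D}].
Proof.
move=> hD /touchesP[a aD ua] /touchesP[b bD vb] uv nuv.
case/connectP: (hD a b aD bD) => p hp hb.
have hpD : {subset a :: p <= D}.
  elim: p a aD hp {ua hb} => [|c p IH] a aD /=.
    by move=> _ t; rewrite inE => /eqP->.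
  case/andP=> /and3P[_ cD _] /(IH c cD) h t; rewrite inE => /orP[/eqP->//|].
  exact: h.
have: path (@adj G) u (rcons (a :: p) v).
  rewrite rcons_path /= ua -hb adjC vb andbT.
  by apply: sub_path hp => c d /and3P[].
case/path_chordless; case/lastP => [|q t] h [].
  by rewrite last_rcons /= => e; rewrite e eqxx in uv.
rewrite !last_rcons => et hs; subst t; exists q; split=> //.
  by apply/eqP=> e; move: h; rewrite e /= (negbTE nuv).
move=> t tq; have: t \in rcons (a :: p) v.
  by apply: hs; rewrite mem_rcons inE tq orbT.
rewrite mem_rcons inE => /orP[/eqP e|/hpD//].
have /chordless_uniq: chordless (rcons q v) := chordless_behead h.
by rewrite rcons_uniq -e tq.
Qed.

Definition component X v := [set w | connect (del_adj X) v w].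

Lemma component_sub X v w : v \notin X -> w \in component X v -> w \notin X.
Proof.
move=> vX; rewrite inE.
apply: (connect_invariant (S := fun t => t \notin X)) => //= a b _.
by case/and3P.
Qed.

Lemma component_id X v : v \in component X v.
Proof. by rewrite inE. Qed.

Lemma component_closed X v w y : v \notin X ->
  w \in component X v -> w -- y -> y \notin X -> y \in component X v.
Proof.
move=> vX hw wy yX; have wX := component_sub vX hw; move: hw; rewrite !inE => h.
by apply: connect_trans h _; apply: connect1; rewrite /del_adj /= wX yX.
Qed.

Lemma del_adj_sym X : connect_sym (del_adj X).
Proof.
by apply: sym_connect_sym => a b; rewrite /del_adj /= adjC andbCA.
Qed.

Lemma component_conn X v : v \notin X -> conn (component X v).
Proof.
move=> vX.
have h a : a \in component X v -> connect (fun a b =>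
  [&& a \in component X v, b \in component X v & a -- b]) v a.
  rewrite inE => /connectP [p].
  elim/last_ind: p a => [|p b IH] a; first by move=> _ ->.
  rewrite rcons_path last_rcons => /andP[hp lb] ->.
  apply: connect_trans (IH _ hp erefl) _; apply: connect1.
  have hl : last v p \in component X v by rewrite inE; apply/connectP; exists p.
  case/and3P: lb => _ bX lb.
  by rewrite hl lb (component_closed vX hl lb bX).
move=> a b ha hb; apply: connect_trans (h b hb).
rewrite sym_connect_sym ?h // => c d.
by rewrite adjC andbCA.
Qed.

Lemma chordless_adj p u v : chordless p -> u \in p -> v \in p -> u -- v ->
  exists p1 p2, p = p1 ++ u :: v :: p2 \/ p = p1 ++ v :: u :: p2.
Proof.
elim: p => [|x [|y s] IH] //.
  by move=> _; rewrite !inE => /eqP-> /eqP->; rewrite adj_irr.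
rewrite chordless_cons => /and4P[xy xn /allP xs h] hu hv uv.
have key t : t \in y :: s -> x -- t -> t = y.
  by rewrite inE => /orP[/eqP//|/xs/negP].
case: (eqVneq u x) (hu) => [ux _|ux].
  subst u; move: hv; rewrite inE => /orP[/eqP vx|hv].
    by rewrite vx adj_irr in uv.
  by rewrite (key v hv uv); exists [::], s; left.
rewrite inE (negbTE ux) => hu'.
case: (eqVneq v x) (hv) => [vx _|vx].
  subst v; rewrite adjC in uv.
  by rewrite (key u hu' uv); exists [::], s; right.
rewrite inE (negbTE vx) => hv'.
by case: (IH h hu' hv' uv) => p1 [p2 [->|->]]; exists (x :: p1), p2; [left|right].
Qed.

Lemma chordless_induced_path x p : chordless (x :: p) -> induced_path (x :: p).
Proof.
move=> h; have hu := chordless_uniq h; split.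
  by rewrite /is_path hu /=; apply: chordless_path.
move=> u v up vp uv; case: (chordless_adj h up vp uv) => p1 [p2 []] e.
  left; move: hu; rewrite e => hu; move: (hu).
  rewrite cat_uniq /= => /and4P[_ /norP[u1 /norP[v1 _]] /norP[uv' _] _].
  rewrite !index_cat (negbTE u1) (negbTE v1) /= !eqxx (negbTE (adj_neq uv)).
  by rewrite addn0 addn1.
right; move: hu; rewrite e => hu; move: (hu).
rewrite cat_uniq /= => /and4P[_ /norP[u1 /norP[v1 _]] /norP[uv' _] _].
rewrite !index_cat (negbTE u1) (negbTE v1) /= !eqxx eq_sym (negbTE (adj_neq uv)).
by rewrite addn0 addn1.
Qed.

Lemma next_mid (T : eqType) (p1 p2 : seq T) (u v : T) :
  uniq (p1 ++ u :: v :: p2) -> next (p1 ++ u :: v :: p2) u = v.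
Proof.
by move=> h; rewrite -(next_rot (size p1) h) rot_size_cat /= eqxx.
Qed.

Lemma next_last (T : eqType) (x z : T) (p : seq T) :
  uniq (x :: rcons p z) -> next (x :: rcons p z) z = x.
Proof.
move=> h; rewrite -(next_rot (size (x :: p)) h).
rewrite -rcons_cons -cats1 rot_size_cat /=.
by rewrite eqxx.
Qed.

Lemma chordless_induced_cycle x y s z :
  chordless (y :: rcons s z) -> x -- y -> x -- z ->
  x \notin y :: rcons s z -> all (fun t => ~~ x -- t) s ->
  induced_cycle (x :: y :: rcons s z).
Proof.
move=> h xy xz xn /allP xs.
have hu : uniq (x :: y :: rcons s z) by rewrite cons_uniq xn chordless_uniq.
have key t : t \in y :: rcons s z -> x -- t ->
    t = next (x :: y :: rcons s z) x \/ x = next (x :: y :: rcons s z) t.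
  rewrite inE mem_rcons inE => /or3P[/eqP->|/eqP->|/xs/negP//] _.
    by left; rewrite /= eqxx.
  by right; rewrite -rcons_cons next_last.
split.
  apply/and3P; split=> //; first by rewrite /= size_rcons.
  by rewrite /= xy /= rcons_path chordless_path //= last_rcons adjC.
move=> u v hu1 hv1 uv.
case: (eqVneq u x) (hu1) => [ux _|ux].
  subst u; move: hv1; rewrite inE => /orP[/eqP vx|hv]; last exact: key.
  by rewrite vx adj_irr in uv.
rewrite inE (negbTE ux) => hu'.
case: (eqVneq v x) (hv1) => [vx _|vx].
  by subst v; rewrite adjC in uv; case: (key u hu' uv); [right|left].
rewrite inE (negbTE vx) => hv'.
case: (chordless_adj h hu' hv' uv) => p1 [p2 []] e; [left|right].
  by move: hu; rewrite e -cat_cons => /next_mid ->.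
by move: hu; rewrite e -cat_cons => /next_mid ->.
Qed.

Hypothesis hG : pentagraph G.

Lemma no_triangle a b c : a -- b -> b -- c -> c -- a -> False.
Proof.
move=> ab bc ca; have: is_cycle [:: a; b; c].
  rewrite /is_cycle /= ab bc ca !inE !negb_or.
  by rewrite (adj_neq ab) (adj_neq bc) eq_sym (adj_neq ca).
by move/hG.1.
Qed.

Lemma no_square a b c d : a != c -> b != d ->
  a -- b -> b -- c -> c -- d -> d -- a -> False.
Proof.
move=> ac bd ab bc cd da; have: is_cycle [:: a; b; c; d].
  rewrite /is_cycle /= ab bc cd da !inE !negb_or.
  by rewrite (adj_neq ab) (adj_neq bc) (adj_neq cd) ac bd eq_sym (adj_neq da).
by move/hG.1.
Qed.

Lemma common_nbr a b u v : a != b ->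
  a -- u -> b -- u -> a -- v -> b -- v -> u = v.
Proof.
move=> ab au bu av bv; apply/eqP; apply/negPn/negP => uv.
by apply: (no_square ab uv au _ bv); rewrite adjC.
Qed.

(** The hole consists of [s], [x], [y] and [z], hence has [size s + 3] vertices; when this is odd it
    must be five. *)
Lemma odd_hole x y s z :
  chordless (y :: rcons s z) -> x -- y -> x -- z ->
  x \notin y :: rcons s z -> all (fun t => ~~ x -- t) s ->
  ~~ odd (size s) -> size s = 2.
Proof.
move=> h xy xz xn xs so.
have /hG.2 := chordless_induced_cycle h xy xz xn xs.
by rewrite /= size_rcons /= (negbTE so) => /(_ isT) [].
Qed.

Definition anticomplete p q := {in p & q, forall x y, x != y /\ ~~ x -- y}.

Lemma chordless_cat p x q : chordless (rcons p x) -> chordless (x :: q) ->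
  anticomplete p q -> chordless (p ++ x :: q).
Proof.
elim: p => [|a p IH] //.
rewrite rcons_cons => h hq hpq.
have h' : chordless (p ++ x :: q).
  apply: IH hq _; first exact: chordless_behead h.
  by move=> t u tp uq; apply: hpq => //; rewrite inE tp orbT.
have aq : a \notin q.
  by apply/negP=> aq; case: (hpq a a (mem_head _ _) aq); rewrite eqxx.
have adq : all (fun z => ~~ a -- z) q.
  by apply/allP=> t tq; case: (hpq a t (mem_head _ _) tq).
case: p h h' {IH hpq} => [|b p].
  by move=> /= /andP[ax _] h'; rewrite ax adq h' inE negb_or aq (adj_neq ax).
rewrite rcons_cons !cat_cons !chordless_cons => /and4P[ab an aall _] ->.
rewrite ab andbT all_cat /= adq andbT.
move: an aall; rewrite !inE mem_cat mem_rcons all_rcons !inE !negb_or.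
by rewrite aq andbT => /and3P[-> -> ->] /andP[-> ->].
Qed.

(** The two paths close up to a hole with [size p + size q + 2] vertices. This is the main source of
    contradictions: it suffices to exhibit an odd sum other than three. *)
Lemma glue_odd a b p q :
  chordless (a :: rcons p b) -> chordless (a :: rcons q b) ->
  p != [::] -> q != [::] -> anticomplete p q ->
  odd (size p + size q) -> size p + size q = 3.
Proof.
move=> hp hq p0 q0 hpq so.
have hc : chordless (p ++ b :: rev q).
  apply: chordless_cat; first exact: chordless_behead hp.
    by have := chordless_rev (chordless_behead hq); rewrite rev_rcons.
  by move=> t u tp; rewrite mem_rev; apply: hpq.
case: p p0 hp hpq so hc => // y p _.
case: q q0 hq => // z q _ hq hp hpq so hc.
have aq : a \notin rcons (z :: q) b.
  by move/chordless_uniq: hq; rewrite cons_uniq => /andP[].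
have ap : a \notin rcons (y :: p) b.
  by move/chordless_uniq: hp; rewrite cons_uniq => /andP[].
move: hp hq; rewrite !rcons_cons !chordless_cons !all_rcons.
move=> /and4P[ay _ /andP[nab pall] _] /and4P[az _ /andP[_ qall] _].
have e : (y :: p) ++ b :: rev (z :: q) = y :: rcons (p ++ b :: rev q) z.
  by rewrite rev_cons -cats1 -!cats1 -!catA.
rewrite e in hc.
have ss : size (p ++ b :: rev q) = (size p + size q).+1.
  by rewrite size_cat /= size_rev addnS.
have := odd_hole hc ay az; rewrite ss => hh.
rewrite /= addnS; congr S; apply: hh.
- move: ap aq; rewrite !inE !mem_rcons !inE mem_cat !inE mem_rev !negb_or.
  by move=> /and3P[-> -> ->] /and3P[-> _ ->].
- by rewrite all_cat /= all_rev pall nab qall.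
by move: so; rewrite /= addnS /= negbK.
Qed.

End Chordless.

(** * Star cutsets *)

Section Good.

Variable G : sgraph.
Implicit Types (a b c d x y z u v w : G) (p q r s : seq G) (X D W : {set G}).

Hypothesis hG : pentagraph G.

Definition hole5 (c1 c2 c3 c4 c5 : G) : bool :=
  [&& uniq [:: c1; c2; c3; c4; c5],
      c1 -- c2, c2 -- c3, c3 -- c4, c4 -- c5 & c5 -- c1].

(* [W] is a component of [G \ N[x]]; the neighbour [z] of [x] outside [N(W)] is
   what makes the star cutset [x + N(W)] strong. *)
Record good x W : Prop := Good {
  good_n0 : exists w, w \in W;
  good_conn : conn W;
  good_off : forall w, w \in W -> (w != x) && ~~ x -- w;
  good_closed : forall w y, w \in W -> w -- y -> (y \in W) || (x -- y);
  good_out : exists2 z, x -- z & ~~ touches W z }.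

Lemma touchesI W y w : w \in W -> y -- w -> touches W y.
Proof. by move=> wW yw; apply/touchesP; exists w. Qed.

(** Any two vertices of [X] other than [x] are joined through [W] and through the component [A] of
    [z]. If a path through [A] has odd length, parity makes the one through [W] odd too, and closing
    that one with [x] gives a 5-hole. Otherwise [X] is a cutset of the required kind, strong because
    [z] lies in [A]. *)
Lemma good_hole5 x W : good x W ->
  (exists X, strong_parity_star_cutset X) \/
  exists a c d b, [/\ c \in W, d \in W & hole5 x a c d b].
Proof.
case=> [[w0 w0W] cW oW clW [z xz nz]].
case: (classic (exists a c d b, [/\ c \in W, d \in W & hole5 x a c d b])).
  by right.
move=> noh; left.
pose X1 := [set y | (y == x) || (x -- y) && touches W y].
have zX1 : z \notin X1 by rewrite inE eq_sym (negbTE (adj_neq xz)) (negbTE nz) andbF.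
pose A := component X1 z.
pose X := [set y | (y == x) || [&& x -- y, touches W y & touches A y]].
have XX1 y : y \in X -> y \in X1.
  by rewrite !inE => /orP[->//|/and3P[-> -> _]]; rewrite orbT.
have AX1 v : v \in A -> v \notin X1 by apply: component_sub.
have AX v : v \in A -> v \notin X by move/AX1; apply: contra; apply: XX1.
have Acl v y : v \in A -> v -- y -> y \notin X -> y \in A.
  move=> vA vy; apply: contraR => yA.
  have : y \in X1 by apply: contraR yA => yX1; apply: component_closed vy yX1.
  rewrite !inE => /orP[->//|/andP[-> ->]] /=.
  by rewrite (touchesI vA) ?orbT // adjC.
have zA : z \in A by apply: component_id.
have AW v : v \in A -> v \notin W.
  rewrite inE; apply: (connect_invariant (S := fun t => t \notin W)).
    move=> a b /= aW /and3P[aX _ ab]; apply: contra aX => bW.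
    rewrite adjC in ab; have := clW _ _ bW ab; rewrite (negbTE aW) /= => xa.
    by rewrite inE xa (touchesI bW) ?orbT // adjC.
  by apply: contra nz => /= zW; have := oW _ zW; rewrite xz andbF.
have AWadj v w : v \in A -> w \in W -> ~~ v -- w.
  move=> vA wW; apply/negP=> vw; have vW := AW _ vA.
  rewrite adjC in vw; have := clW _ _ wW vw; rewrite (negbTE vW) /= => xv.
  move: (AX1 _ vA); rewrite inE xv (touchesI wW) ?orbT // adjC //.
(* The vertices dropped from [X1] to form [X] do not touch [A], so [A] remains a component. *)
have AE : A = component X z.
  apply/setP=> v; apply/idP/idP; rewrite ![in X in X -> _]inE.
    move=> h; rewrite inE; apply: connect_sub h => a b /and3P[aX bX ab].
    apply: connect1; rewrite /del_adj /= ab andbT.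
    by apply/andP; split; [apply: contra aX | apply: contra bX]; apply: XX1.
  apply: (connect_invariant (S := fun t => t \in A)) => //= a b aA.
  by case/and3P=> _ bX ab; apply: Acl ab bX.
have w0X : w0 \notin X.
  apply/negP=> /XX1; have /andP[w0x xw0] := oW _ w0W.
  by rewrite inE (negbTE w0x) (negbTE xw0).
exists X, x, A; split; last by exists z.
split.
- exists z, w0; split; [exact: AX | exact: w0X | apply/negP=> h].
  have w0A : w0 \in A by rewrite AE inE.
  by move: (AW _ w0A); rewrite w0W.
- split; first by rewrite inE eqxx.
  by move=> y; rewrite !inE => /andP[/negbTE-> /= /and3P[]].
- by exists z; rewrite ?AX.
move=> a b; rewrite !inE => /andP[/negbTE-> /= /and3P[xa Wa Aa]].
move=> /andP[/negbTE-> /= /and3P[xb Wb Ab]] ab.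
have nab : ~~ a -- b.
  by apply/negP=> h; rewrite adjC in xb; apply: (no_triangle hG xa h xb).
have [q [hq q0 qA]] := conn_chordless (component_conn zX1) Aa Ab ab nab.
have [r [hr r0 rW]] := conn_chordless cW Wa Wb ab nab.
exists q; split=> //; first exact: chordless_induced_path.
rewrite /= negbK; apply: contraT => eq.
(* A single interior vertex would form a 4-cycle with [a], [x] and [b]. Hence both interiors have at
   least two vertices, too many for a 5-hole through [A] and [W]. *)
have big (t : seq G) : chordless (a :: rcons t b) -> t != [::] -> x \notin t ->
    2 <= size t.
  case: t => [|t0 [|]] // ht _ xt; exfalso.
  move: ht; rewrite /= => /andP[at0 /andP[_ /andP[_ /andP[t0b _]]]].
  apply: (no_square hG ab _ at0 t0b _ xa); last by rewrite adjC.
  by rewrite mem_seq1 eq_sym in xt.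
have xq : x \notin q by apply/negP=> /qA/AX1; rewrite inE eqxx.
have xr : x \notin r by apply/negP=> /rW/oW; rewrite eqxx.
have qr : anticomplete q r.
  move=> s t /qA sA /rW tW; split; last exact: AWadj.
  by apply: contraNneq (AW _ sA) => ->.
have := big q hq q0 xq; have := big r hr r0 xr => br bq.
have er : ~~ odd (size r).
  apply/negP=> or; have := glue_odd hG hq hr q0 r0 qr.
  rewrite oddD (negbTE eq) or => /(_ isT) e.
  by have : 4 <= 3; [rewrite -{2}e (leq_add bq br) | ].
have xc : x \notin a :: rcons r b.
  by rewrite inE mem_rcons inE !negb_or xr (adj_neq xa) (adj_neq xb).
have xall : all (fun t => ~~ x -- t) r.
  by apply/allP=> t /rW/oW/andP[].
have s2 := odd_hole hG hr xa xb xc xall er.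
case: noh; case: r s2 hr rW xc xr {qr br er xall r0} => [|c [|d []]] // _ hr rW xc xr.
exists a, c, d, b; split; try by apply: rW; rewrite !inE eqxx ?orbT.
have hu := chordless_uniq hr; move: hr; rewrite /= => /and4P[ac _ _ /and4P[cd _ _ /andP[db _]]].
by rewrite /hole5 cons_uniq xc hu xa ac cd db adjC xb.
Qed.

End Good.

(** * 5-holes and the components avoiding their neighbourhood *)

Section FarComponents.

Variable G : sgraph.
Implicit Types (a b c d x y z u v w : G).
Implicit Types (p q r s : seq G) (X D W : {set G}).

Hypothesis hG : pentagraph G.

Lemma hole5_rot c1 c2 c3 c4 c5 :
  hole5 c1 c2 c3 c4 c5 -> hole5 c2 c3 c4 c5 c1.
Proof.
rewrite /hole5 => /and5P[hu -> -> -> /andP[-> ->]].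
by have -> : uniq [:: c2; c3; c4; c5; c1] by rewrite -(rot_uniq 1) in hu.
Qed.

Lemma hole5_rev c1 c2 c3 c4 c5 :
  hole5 c1 c2 c3 c4 c5 -> hole5 c5 c4 c3 c2 c1.
Proof.
rewrite /hole5 => /and5P[hu c12 c23 c34 /andP[c45 c51]].
have -> : uniq [:: c5; c4; c3; c2; c1] by rewrite -rev_uniq in hu.
by rewrite adjC c45 adjC c34 adjC c23 adjC c12 adjC c51.
Qed.

Lemma hole5_nadj c1 c2 c3 c4 c5 :
  hole5 c1 c2 c3 c4 c5 -> (c1 -- c3) = false.
Proof.
case/and5P=> _ c12 c23 _ _; apply/negP=> c13; rewrite adjC in c13.
exact: no_triangle c12 c23 c13.
Qed.

(** Packed as one tuple of equations in both orientations, so that a single [rewrite] evaluates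
    every adjacency and equality on the 5-hole. *)
Lemma hole5E c1 c2 c3 c4 c5 : hole5 c1 c2 c3 c4 c5 ->
  ((((c1 -- c2) = true) * ((c2 -- c3) = true) * ((c3 -- c4) = true) *
    ((c4 -- c5) = true) * ((c5 -- c1) = true)) *
   (((c2 -- c1) = true) * ((c3 -- c2) = true) * ((c4 -- c3) = true) *
    ((c5 -- c4) = true) * ((c1 -- c5) = true)) *
   (((c1 -- c3) = false) * ((c2 -- c4) = false) * ((c3 -- c5) = false) *
    ((c4 -- c1) = false) * ((c5 -- c2) = false)) *
   (((c3 -- c1) = false) * ((c4 -- c2) = false) * ((c5 -- c3) = false) *
    ((c1 -- c4) = false) * ((c2 -- c5) = false)) *
   (((c1 == c2) = false) * ((c2 == c3) = false) * ((c3 == c4) = false) *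
    ((c4 == c5) = false) * ((c5 == c1) = false)) *
   (((c2 == c1) = false) * ((c3 == c2) = false) * ((c4 == c3) = false) *
    ((c5 == c4) = false) * ((c1 == c5) = false)) *
   (((c1 == c3) = false) * ((c2 == c4) = false) * ((c3 == c5) = false) *
    ((c4 == c1) = false) * ((c5 == c2) = false)) *
   (((c3 == c1) = false) * ((c4 == c2) = false) * ((c5 == c3) = false) *
    ((c1 == c4) = false) * ((c2 == c5) = false)))%type.
Proof.
move=> h.
have n13 := hole5_nadj h; have h2 := hole5_rot h.
have n24 := hole5_nadj h2; have h3 := hole5_rot h2.
have n35 := hole5_nadj h3; have h4 := hole5_rot h3.
have n41 := hole5_nadj h4; have n52 := hole5_nadj (hole5_rot h4).
have n31 := n13; have n42 := n24; have n53 := n35; have n14 := n41; have n25 := n52.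
rewrite adjC in n31; rewrite adjC in n42; rewrite adjC in n53.
rewrite adjC in n14; rewrite adjC in n25.
case/and5P: h; rewrite /= !inE !negb_or.
case/and5P=> /and4P[/negbTE e12 /negbTE e13 /negbTE e14 /negbTE e15]
  /and3P[/negbTE e23 /negbTE e24 /negbTE e25] /andP[/negbTE e34 /negbTE e35] /negbTE e45 _.
move=> c12 c23 c34 /andP[c45 c51].
have [c21 c32 c43 c54 c15] :
  [/\ c2 -- c1, c3 -- c2, c4 -- c3, c5 -- c4 & c1 -- c5] by split; rewrite adjC.
have [f21 f31 f41 f51] :
  [/\ (c2 == c1) = false, (c3 == c1) = false, (c4 == c1) = false & (c5 == c1) = false].
  by split; rewrite eq_sym.
have [f32 f42 f52] :
  [/\ (c3 == c2) = false, (c4 == c2) = false & (c5 == c2) = false].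
  by split; rewrite eq_sym.
have [f43 f53 f54] :
  [/\ (c4 == c3) = false, (c5 == c3) = false & (c5 == c4) = false].
  by split; rewrite eq_sym.
by do !split.
Qed.

(** A second neighbour on the 5-hole would close a triangle or a 4-cycle. The form is again that of
    a rewriting table. *)
Lemma one_nbr c1 c2 c3 c4 c5 v : hole5 c1 c2 c3 c4 c5 ->
  v \notin [:: c1; c2; c3; c4; c5] -> v -- c1 ->
  ((((v -- c1) = true) * ((v -- c2) = false) * ((v -- c3) = false) *
    ((v -- c4) = false) * ((v -- c5) = false)) *
   (((c1 -- v) = true) * ((c2 -- v) = false) * ((c3 -- v) = false) *
    ((c4 -- v) = false) * ((c5 -- v) = false)) *
   (((v == c1) = false) * ((v == c2) = false) * ((v == c3) = false) *
    ((v == c4) = false) * ((v == c5) = false)) *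
   (((c1 == v) = false) * ((c2 == v) = false) * ((c3 == v) = false) *
    ((c4 == v) = false) * ((c5 == v) = false)))%type.
Proof.
move=> h; have E := hole5E h; rewrite !inE !negb_or.
case/and5P=> /negbTE v1 /negbTE v2 /negbTE v3 /negbTE v4 /negbTE v5 vc.
have n2 : (v -- c2) = false.
  apply/negP=> h'; apply: (@no_triangle _ hG v c1 c2) => //; first by rewrite E.
  by rewrite adjC.
have n5 : (v -- c5) = false.
  apply/negP=> h'; apply: (@no_triangle _ hG v c1 c5) => //; first by rewrite E.
  by rewrite adjC.
have n3 : (v -- c3) = false.
  apply/negP=> h'; apply: (@no_square _ hG v c1 c2 c3); rewrite ?E ?v2 //.
  by rewrite adjC.
have n4 : (v -- c4) = false.
  apply/negP=> h'; apply: (@no_square _ hG v c1 c5 c4); rewrite ?E ?v5 //.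
  by rewrite adjC.
have [m1 [m2 m3] [m4 m5]] : [/\ c1 -- v, (c2 -- v) = false /\ (c3 -- v) = false
  & (c4 -- v) = false /\ (c5 -- v) = false].
  by split; rewrite ?[_ -- v]adjC.
have [f1 [f2 f3] [f4 f5]] : [/\ (c1 == v) = false, (c2 == v) = false /\ (c3 == v) = false
  & (c4 == v) = false /\ (c5 == v) = false].
  by split; rewrite ?[_ == v]eq_sym.
by do !split.
Qed.

Definition nbC c1 c2 c3 c4 c5 v :=
  [|| v -- c1, v -- c2, v -- c3, v -- c4 | v -- c5].

(* [D] is a component of [G \ N[C]] for the 5-cycle [C]; since a cycle lies in
   its own neighbourhood, [nbC] needs no separate membership test. *)
Record far_comp c1 c2 c3 c4 c5 D : Prop := FarComp {
  far_n0 : exists w, w \in D;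
  far_conn : conn D;
  far_off : forall w, w \in D -> ~~ nbC c1 c2 c3 c4 c5 w;
  far_closed : forall w y, w \in D -> w -- y ->
    (y \in D) || nbC c1 c2 c3 c4 c5 y }.

Lemma nbC_rot c1 c2 c3 c4 c5 v : nbC c2 c3 c4 c5 c1 v = nbC c1 c2 c3 c4 c5 v.
Proof. by rewrite /nbC; case: (v -- c1) (v -- c2) (v -- c3) (v -- c4) (v -- c5) => [] [] [] [] []. Qed.

Lemma nbC_rev c1 c2 c3 c4 c5 v : nbC c5 c4 c3 c2 c1 v = nbC c1 c2 c3 c4 c5 v.
Proof. by rewrite /nbC; case: (v -- c1) (v -- c2) (v -- c3) (v -- c4) (v -- c5) => [] [] [] [] []. Qed.

Lemma far_comp_rot c1 c2 c3 c4 c5 D :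
  far_comp c1 c2 c3 c4 c5 D -> far_comp c2 c3 c4 c5 c1 D.
Proof.
case=> h1 h2 h3 h4; split=> // [w|w y]; rewrite nbC_rot; [exact: h3|exact: h4].
Qed.

Lemma far_comp_rev c1 c2 c3 c4 c5 D :
  far_comp c1 c2 c3 c4 c5 D -> far_comp c5 c4 c3 c2 c1 D.
Proof.
case=> h1 h2 h3 h4; split=> // [w|w y]; rewrite nbC_rev; [exact: h3|exact: h4].
Qed.

(** For [v] on a 5-hole and [D] far from it, this says that the class of [v] meets the boundary of
    [D]; [v] itself never touches [D]. *)
Definition attached D v := [exists y, (y -- v) && touches D y].

Lemma attachedP D v : reflect (exists2 y, y -- v & touches D y) (attached D v).
Proof.
apply: (iffP existsP) => [[y /andP[h1 h2]]|[y h1 h2]]; exists y => //.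
by rewrite h1.
Qed.

Section Hole.

Variables c1 c2 c3 c4 c5 : G.
Hypothesis hC : hole5 c1 c2 c3 c4 c5.
Let E := hole5E hC.

Lemma nbC_hole c : c \in [:: c1; c2; c3; c4; c5] -> nbC c1 c2 c3 c4 c5 c.
Proof.
by rewrite !inE /nbC => /or4P[|||/orP[]] /eqP->; rewrite !E ?orbT.
Qed.

Variable D : {set G}.
Hypothesis hD : far_comp c1 c2 c3 c4 c5 D.

Lemma touches_off y : touches D y -> y \notin [:: c1; c2; c3; c4; c5].
Proof.
case/touchesP=> w wD yw; apply/negP; move: (far_off hD wD).
rewrite !inE /nbC !negb_or ![w -- _]adjC.
case/and5P=> n1 n2 n3 n4 n5.
by case/or4P=> [|||/orP[]] /eqP e; move: yw; rewrite e; apply/negP.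
Qed.

Lemma touches_notin y : touches D y -> nbC c1 c2 c3 c4 c5 y -> y \notin D.
Proof. by move=> _; apply: contraL => /(far_off hD). Qed.

Lemma far_anti q r : {subset q <= D} -> {subset r <= [:: c1; c2; c3; c4; c5]} ->
  anticomplete q r.
Proof.
move=> qD rC x y /qD xD /rC yC; have xf := far_off hD xD; split.
  by apply: contraNneq xf => ->; apply: nbC_hole.
move: yC xf; rewrite !inE /nbC !negb_or => yC /and5P[n1 n2 n3 n4 n5].
by case/or4P: yC => [|||/orP[]] /eqP->.
Qed.

Lemma touches_nbC y : touches D y -> (y \in D) || nbC c1 c2 c3 c4 c5 y.
Proof. by case/touchesP=> w wD yw; apply: (far_closed hD wD); rewrite adjC. Qed.

(** If not, a path [q] through [D] could be closed by [c1 c2 c3] or by [c1 c5 c4 c3]. One sum of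
    interiors is odd, and it exceeds three because [q] is nonempty. *)
Lemma dist2_adj a b : touches D a -> touches D b -> a -- c1 -> b -- c3 -> a -- b.
Proof.
move=> ta tb ac bc; apply/negPn/negP => nab.
have Ea := one_nbr hC (touches_off ta) ac.
have bC : b \notin [:: c3; c4; c5; c1; c2].
  by move: (touches_off tb); rewrite !inE !negb_or; case: (b == c1) (b == c2) (b == c3) (b == c4) (b == c5) => [] [] [] [] [].
have Eb := one_nbr (hole5_rot (hole5_rot hC)) bC bc.
have ab : (a == b) = false.
  by apply/negbTE/eqP=> e; move: bc; rewrite -e Ea.
have [q [hq q0 qD]] := conn_chordless (far_conn hD) ta tb (negbT ab) nab.
have h1 : chordless (a :: rcons [:: c1; c2; c3] b).
  by rewrite /= !inE ?(E, Ea, Eb, ab) (negbTE nab).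
have h2 : chordless (a :: rcons [:: c1; c5; c4; c3] b).
  by rewrite /= !inE ?(E, Ea, Eb, ab) (negbTE nab).
have a1 : anticomplete q [:: c1; c2; c3].
  by apply: far_anti => // t; rewrite !inE => /or3P[] /eqP->; rewrite eqxx ?orbT.
have a2 : anticomplete q [:: c1; c5; c4; c3].
  by apply: far_anti => // t; rewrite !inE => /or4P[] /eqP->; rewrite eqxx ?orbT.
have sq : size q != 0 by rewrite size_eq0.
have g1 := glue_odd hG hq h1 q0 isT a1; have g2 := glue_odd hG hq h2 q0 isT a2.
move: sq g1 g2; rewrite !oddD /=; case: (size q) => //= n _.
by case: (odd n) => /= g1 g2; [have := g1 isT | have := g2 isT]; rewrite addnC.
Qed.

(** The detour [c1 c2] contributes two interior vertices, so the resulting odd hole leaves only one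
    for [q]. *)
Lemma crossing_odd a b q : a -- c1 -> b -- c2 -> touches D a -> touches D b ->
  chordless (a :: rcons q b) -> q != [::] -> {subset q <= D} ->
  odd (size q) -> size q = 1.
Proof.
move=> ac bc ta tb hq q0 qD oq.
have Ea := one_nbr hC (touches_off ta) ac.
have bC : b \notin [:: c2; c3; c4; c5; c1].
  by move: (touches_off tb); rewrite !inE !negb_or; case: (b == c1) (b == c2) (b == c3) (b == c4) (b == c5) => [] [] [] [] [].
have Eb := one_nbr (hole5_rot hC) bC bc.
have ab : (a == b) = false.
  by apply/negbTE/eqP=> e; move: bc; rewrite -e Ea.
have nab : (a -- b) = false.
  by apply/negP=> h; apply: (@no_square _ hG a c1 c2 b); rewrite ?(E, Ea, Eb) // adjC.
have h1 : chordless (a :: rcons [:: c1; c2] b).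
  by rewrite /= !inE ?(E, Ea, Eb, ab, nab).
have a1 : anticomplete q [:: c1; c2].
  by apply: far_anti => // t; rewrite !inE => /orP[] /eqP->; rewrite eqxx ?orbT.
have := glue_odd hG hq h1 q0 isT a1.
by rewrite oddD oq /= => /(_ isT); rewrite addn2 => -[->].
Qed.

(* Otherwise the hole [a q b y c5 c1] would be odd. *)
Lemma even_crossing_no5 a b q y : a -- c1 -> b -- c2 -> touches D a -> touches D b ->
  chordless (a :: rcons q b) -> q != [::] -> {subset q <= D} ->
  ~~ odd (size q) -> y \notin [:: c1; c2; c3; c4; c5] -> y -- c5 ->
  ~~ touches D y -> b -- y -> False.
Proof.
move=> ac bc ta tb hq q0 qD oq yC yc ty bay.
have Ea := one_nbr hC (touches_off ta) ac.
have bC : b \notin [:: c2; c3; c4; c5; c1].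
  by move: (touches_off tb); rewrite !inE !negb_or; case: (b == c1) (b == c2) (b == c3) (b == c4) (b == c5) => [] [] [] [] [].
have Eb := one_nbr (hole5_rot hC) bC bc.
have yC' : y \notin [:: c5; c1; c2; c3; c4].
  by move: yC; rewrite !inE !negb_or; case: (y == c1) (y == c2) (y == c3) (y == c4) (y == c5) => [] [] [] [] [].
have Ey := one_nbr (hole5_rot (hole5_rot (hole5_rot (hole5_rot hC)))) yC' yc.
have ab : (a == b) = false.
  by apply/negbTE/eqP=> e; move: bc; rewrite -e Ea.
have ay : (a == y) = false.
  by apply/negbTE/eqP=> e; move: yc; rewrite -e Ea.
have yb : (y == b) = false.
  by apply/negbTE/eqP=> e; move: yc; rewrite e Eb.
have nab : (a -- b) = false.
  by apply/negP=> h; apply: (@no_square _ hG a c1 c2 b); rewrite ?(E, Ea, Eb) // adjC.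
have nay : (a -- y) = false.
  by apply/negP=> h; apply: (@no_square _ hG a c1 c5 y); rewrite ?(E, Ea, Ey) // adjC.
have yab : y -- b by rewrite adjC.
have h1 : chordless (a :: rcons [:: c1; c5; y] b).
  by rewrite /= !inE ?(E, Ea, Eb, Ey, ab, nab, ay, nay, yb, yab).
have a1 : anticomplete q [:: c1; c5; y].
  move=> t u tq; rewrite -[[:: c1; c5; y]]/([:: c1; c5] ++ [:: y]) mem_cat.
  case/orP=> [h|].
    apply: (far_anti (q := q) (r := [:: c1; c5])) => // t'.
    by rewrite !inE => /orP[] /eqP->; rewrite eqxx ?orbT.
  rewrite inE => /eqP->; split.
    apply/eqP=> e; move: (far_off hD (qD _ tq)).
    by rewrite e /nbC yc !orbT.
  apply: contra ty => ty; apply/touchesP; exists t; [exact: qD|by rewrite adjC].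
have := glue_odd hG hq h1 q0 isT a1.
rewrite oddD (negbTE oq) /= => /(_ isT); case: (q) q0 => // t q' _.
by rewrite addnC.
Qed.

End Hole.

End FarComponents.

(** * Neighbours of a 5-hole and the classes opposite to them *)

Section LocalStructure.

Variable G : sgraph.
Implicit Types (a b c d x y z u v w : G).
Implicit Types (p q r s : seq G) (X D W : {set G}).

Hypothesis hG : pentagraph G.

Lemma notin_rot c1 c2 c3 c4 c5 v :
  v \notin [:: c1; c2; c3; c4; c5] -> v \notin [:: c2; c3; c4; c5; c1].
Proof. by rewrite !inE !negb_or; case: (v == c1) (v == c2) (v == c3) (v == c4) (v == c5) => [] [] [] [] []. Qed.

Local Notation nbr_facts c1 c2 c3 c4 c5 v :=
  ((((v -- c1) = true) * ((v -- c2) = false) * ((v -- c3) = false) *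
    ((v -- c4) = false) * ((v -- c5) = false)) *
   (((c1 -- v) = true) * ((c2 -- v) = false) * ((c3 -- v) = false) *
    ((c4 -- v) = false) * ((c5 -- v) = false)) *
   (((v == c1) = false) * ((v == c2) = false) * ((v == c3) = false) *
    ((v == c4) = false) * ((v == c5) = false)) *
   (((c1 == v) = false) * ((c2 == v) = false) * ((c3 == v) = false) *
    ((c4 == v) = false) * ((c5 == v) = false)))%type.

Lemma one_nbr2 c1 c2 c3 c4 c5 v : hole5 c1 c2 c3 c4 c5 ->
  v \notin [:: c1; c2; c3; c4; c5] -> v -- c2 -> nbr_facts c2 c3 c4 c5 c1 v.
Proof. by move=> h vC; apply: (one_nbr hG (hole5_rot h) (notin_rot vC)). Qed.

Lemma one_nbr3 c1 c2 c3 c4 c5 v : hole5 c1 c2 c3 c4 c5 ->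
  v \notin [:: c1; c2; c3; c4; c5] -> v -- c3 -> nbr_facts c3 c4 c5 c1 c2 v.
Proof. by move=> h vC; apply: (one_nbr2 (hole5_rot h) (notin_rot vC)). Qed.

Lemma one_nbr4 c1 c2 c3 c4 c5 v : hole5 c1 c2 c3 c4 c5 ->
  v \notin [:: c1; c2; c3; c4; c5] -> v -- c4 -> nbr_facts c4 c5 c1 c2 c3 v.
Proof. by move=> h vC; apply: (one_nbr3 (hole5_rot h) (notin_rot vC)). Qed.

Lemma one_nbr5 c1 c2 c3 c4 c5 v : hole5 c1 c2 c3 c4 c5 ->
  v \notin [:: c1; c2; c3; c4; c5] -> v -- c5 -> nbr_facts c5 c1 c2 c3 c4 v.
Proof. by move=> h vC; apply: (one_nbr4 (hole5_rot h) (notin_rot vC)). Qed.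

Lemma degree_gt2 v a : 2 < degree v ->
  exists u w, [/\ v -- u, v -- w, u != w, u != a & w != a].
Proof.
rewrite /degree => h; have : 1 < #|[set w | v -- w] :\ a|.
  by move: h; rewrite (cardsD1 a); case: (a \in _); rewrite ?add0n // => /ltnW.
case/card_gt1P=> u [w []]; rewrite !inE => /andP[ua vu] /andP[wa vw] uw.
by exists u, w.
Qed.

Section Hole.

Variables c1 c2 c3 c4 c5 : G.
Hypothesis hC : hole5 c1 c2 c3 c4 c5.
Let E := hole5E hG hC.
Notation C := [:: c1; c2; c3; c4; c5].

(* Otherwise [c1 c2 n2 m4 c4 n4 n1] is a 7-hole. *)
Lemma jumps_share n1 n2 n4 m4 : n1 \notin C -> n2 \notin C ->
  n4 \notin C -> m4 \notin C -> n1 -- c1 -> n2 -- c2 -> n4 -- c4 -> m4 -- c4 ->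
  n1 -- n4 -> n2 -- m4 -> n4 = m4.
Proof.
move=> h1 h2 h4 h4' a1 a2 a4 a4' j1 j2.
have E1 := one_nbr hG hC h1 a1; have E2 := one_nbr2 hC h2 a2.
have E4 := one_nbr4 hC h4 a4; have E4' := one_nbr4 hC h4' a4'.
apply/eqP; apply: contraT => n44.
have n12 : (n1 -- n2) = false.
  by apply/negP=> h; apply: (@no_square _ hG n1 c1 c2 n2); rewrite ?(E, E1, E2) // adjC.
have n21 : (n2 -- n1) = false by rewrite adjC.
have e12 : (n1 == n2) = false by apply/negbTE/eqP=> e; move: a2; rewrite -e E1.
have n24 : (n2 -- n4) = false.
  apply/negP=> h; move/eqP: n44; apply; apply: (@common_nbr _ hG c4 n2) => //.
  - by rewrite E2.
  - by rewrite E4.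
  - by rewrite E4'.
have n41 : (m4 -- n1) = false.
  apply/negP=> h; move/eqP: n44; apply; apply: (@common_nbr _ hG c4 n1) => //.
  - by rewrite E1.
  - by rewrite E4.
  - by rewrite E4'.
  - by rewrite adjC.
have nm : (m4 -- n4) = false.
  by apply/negP=> h; apply: (@no_triangle _ hG m4 n4 c4); rewrite // E4'.
have e1 : (n1 == n4) = false by apply/negbTE/adj_neq.
have e2 : (n1 == m4) = false by apply/negbTE/eqP=> e; move: a4'; rewrite -e E1.
have e3 : (n2 == n4) = false by apply/negbTE/eqP=> e; move: a4; rewrite -e E2.
have e4 : (n2 == m4) = false by apply/negbTE/adj_neq.
have hp : chordless (c2 :: rcons [:: n2; m4; c4; n4] n1).
  rewrite /= !inE ?(E, E1, E2, E4, E4', n12, n21, n24, n41, nm, j2).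
  by rewrite [n2 == n1]eq_sym [m4 == n1]eq_sym [n4 == n1]eq_sym [n4 -- n1]adjC [m4 == n4]eq_sym
    ?(e12, e1, e2, e3, e4, j1) (negbTE n44).
have := odd_hole hG hp (x := c1); rewrite !inE /= ?(E, E1, E2, E4, E4') /=.
by move=> /(_ isT isT isT isT isT).
Qed.

(** Of the neighbours of [v] other than [c1], none can be adjacent to [c1], [c2] or [c5], and no two
    can share the class of [c3] or of [c4]: each case closes a triangle or a 4-cycle. With two such
    neighbours both classes are hit. *)
Lemma near_nbrs v : 2 < degree v -> v \notin C -> v -- c1 ->
  (forall w, v -- w -> nbC c1 c2 c3 c4 c5 w) ->
  (exists2 u, v -- u & u -- c3) /\ (exists2 u, v -- u & u -- c4).
Proof.
move=> dv vC vc hv; have Ev := one_nbr hG hC vC vc.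
have [u [w [vu vw uw uc wc]]] := degree_gt2 c1 dv.
have key t : v -- t -> t != c1 -> (t -- c3) || (t -- c4).
  move=> vt tc; have := hv _ vt; rewrite /nbC.
  case/or4P=> [h|h|->//|/orP[->|h]]; rewrite ?orbT //; exfalso.
  - by apply: (@no_triangle _ hG v t c1); rewrite // Ev.
  - apply: (@no_square _ hG v t c2 c1); rewrite ?Ev ?E //.
  - apply: (@no_square _ hG v t c5 c1); rewrite ?Ev ?E //.
have one t t' c : v -- t -> v -- t' -> t != t' -> c != v -> t -- c -> t' -- c -> False.
  move=> vt vt' tt cv tc tc'; move/eqP: tt; apply.
  by apply: (@common_nbr _ hG v c) => //; rewrite 1?eq_sym 1?adjC // 1?adjC.
case/orP: (key u vu uc) => hu; case/orP: (key w vw wc) => hw.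
- by case: (one u w c3); rewrite // Ev.
- by split; [exists u | exists w].
- by split; [exists w | exists u].
- by case: (one u w c4); rewrite // Ev.
Qed.

End Hole.
End LocalStructure.

(** * Which classes the boundary of a far component can meet *)

Section Types.

Variable G : sgraph.
Implicit Types (a b c d x y z u v w : G).
Implicit Types (p q r s : seq G) (X D W : {set G}).

(* With [n3] the deleted vertex, adjacent to [c3], [n1] and [n5]. *)
Definition petersen_minus_vertex : Prop :=
  exists c1 c2 c3 c4 c5 n1 n2 n4 n5 : G,
  [/\ hole5 c1 c2 c3 c4 c5,
      [/\ n1 \notin [:: c1; c2; c3; c4; c5], n2 \notin [:: c1; c2; c3; c4; c5],
          n4 \notin [:: c1; c2; c3; c4; c5] & n5 \notin [:: c1; c2; c3; c4; c5]],
      [/\ n1 -- c1, n2 -- c2, n4 -- c4 & n5 -- c5] &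
      [/\ n1 -- n4, n4 -- n2 & n2 -- n5]].

Hypothesis hG : pentagraph G.
Hypothesis hP3 : ~ exists p : seq G, P3_cutset p.
Hypothesis hP9 : ~ petersen_minus_vertex.

(** The adjacencies [a1 a3], [a2 a4] and [a4 a1] forced at distance two are exactly those of the
    Petersen graph minus a vertex, with the hole read from [c3]. *)
Lemma attached_four c1 c2 c3 c4 c5 D :
  hole5 c1 c2 c3 c4 c5 -> far_comp c1 c2 c3 c4 c5 D ->
  attached D c1 -> attached D c2 -> attached D c3 -> attached D c4 -> False.
Proof.
move=> hC hD /attachedP[a1 h1 t1] /attachedP[a2 h2 t2].
move=> /attachedP[a3 h3 t3] /attachedP[a4 h4 t4].
have hC2 := hole5_rot hC; have hD2 := far_comp_rot hD.
have hC3 := hole5_rot hC2; have hD3 := far_comp_rot hD2.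
have hC4 := hole5_rot hC3; have hD4 := far_comp_rot hD3.
have e13 := dist2_adj hG hC hD t1 t3 h1 h3.
have e24 := dist2_adj hG hC2 hD2 t2 t4 h2 h4.
have e41 := dist2_adj hG hC4 hD4 t4 t1 h4 h1.
apply: hP9; exists c3, c4, c5, c1, c2, a3, a4, a1, a2; split=> //.
  by split; apply: (touches_off hD3).
by split; rewrite // adjC.
Qed.

Lemma P3_cutsetI D a b c e w : chordless [:: a; b; c] -> w \in D ->
  e \notin D -> e \notin [:: a; b; c] ->
  a \notin D -> b \notin D -> c \notin D ->
  (forall y, touches D y -> (y \in D) || (y \in [:: a; b; c])) ->
  P3_cutset [:: a; b; c].
Proof.
move=> hp wD eD en aD bD cD hN; split=> //.
  exact: chordless_induced_path.
exists w, e; split.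
- by apply: contraL wD; rewrite !inE => /or3P[] /eqP->.
- by move: en; rewrite !inE.
apply: contra eD; apply: (connect_invariant (S := fun t => t \in D)) => //= u v uD.
case/and3P=> _ vp uv; have tv : touches D v by apply/touchesP; exists u; rewrite // adjC.
by move: vp (hN _ tv); rewrite !inE => /negbTE->; rewrite orbF.
Qed.

(** Two boundary vertices of the same class would share their neighbour on [C] and one of [a1],
    [a4], which makes them equal. So the boundary of [D] is the path [a1 a4 a2], and it separates
    [D] from [c1]. *)
Lemma not_attached124 c1 c2 c3 c4 c5 D :
  hole5 c1 c2 c3 c4 c5 -> far_comp c1 c2 c3 c4 c5 D ->
  attached D c1 -> attached D c2 -> ~~ attached D c4.
Proof.
move=> hC hD t1 t2; apply/negP=> t4.
have hC2 := hole5_rot hC; have hD2 := far_comp_rot hD.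
have hC3 := hole5_rot hC2; have hD3 := far_comp_rot hD2.
have hC4 := hole5_rot hC3; have hD4 := far_comp_rot hD3.
have hC5 := hole5_rot hC4; have hD5 := far_comp_rot hD4.
have nt3 : ~~ attached D c3 by apply/negP=> t3; apply: (attached_four hC hD).
have nt5 : ~~ attached D c5 by apply/negP=> t5; apply: (attached_four hC4 hD4).
case/attachedP: t1 => a1 h1 t1; case/attachedP: t2 => a2 h2 t2.
case/attachedP: t4 => a4 h4 t4.
have e24 := dist2_adj hG hC2 hD2 t2 t4 h2 h4.
have e41 := dist2_adj hG hC4 hD4 t4 t1 h4 h1.
have E1 := one_nbr hG hC (touches_off hD t1) h1.
have E2 := one_nbr2 hG hC (touches_off hD t2) h2.
have E4 := one_nbr4 hG hC (touches_off hD t4) h4.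
have n12 : (a1 -- a2) = false.
  by apply/negP=> h; apply: (no_triangle hG h e24 e41).
have d12 : (a1 == a2) = false by apply/eqP=> e; move: h2; rewrite -e E1.
have e14 : a1 -- a4 by rewrite adjC.
have e42 : a4 -- a2 by rewrite adjC.
have [w wD] := far_n0 hD.
have c1D : c1 \notin D.
  by apply/negP=> /(far_off hD); rewrite (nbC_hole hG hC) // mem_head.
apply: hP3; exists [:: a1; a4; a2]; apply: (@P3_cutsetI D a1 a4 a2 c1 w) => //.
- by rewrite /= !inE e14 e42 n12 d12 (negbTE (adj_neq e14)) (negbTE (adj_neq e42)).
- by rewrite !inE E1 E2 E4.
- by apply: (touches_notin hD t1); rewrite /nbC h1.
- by apply: (touches_notin hD t4); rewrite /nbC h4 !orbT.
- by apply: (touches_notin hD t2); rewrite /nbC h2 !orbT.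
move=> y ty; case/orP: (touches_nbC hD ty) => [->//|].
rewrite /nbC => hy; rewrite !inE; case/or4P: hy => [h|h|h|/orP[h|h]].
- have y4 := dist2_adj hG hC4 hD4 t4 ty h4 h.
  rewrite (@common_nbr _ hG c1 a4 y a1) ?eqxx ?orbT // ?E4 ?E1 //; by rewrite adjC.
- have y4 := dist2_adj hG hC2 hD2 ty t4 h h4.
  by rewrite (@common_nbr _ hG c2 a4 y a2) ?eqxx ?orbT // ?E4 ?E2 // adjC.
- by case/negP: nt3; apply/attachedP; exists y.
- have y1 := dist2_adj hG hC4 hD4 ty t1 h h1.
  rewrite (@common_nbr _ hG c4 a1 y a4) ?eqxx ?orbT // ?E4 ?E1 //; by rewrite adjC.
- by case/negP: nt5; apply/attachedP; exists y.
Qed.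

Definition in_edge D c3 c4 c5 := [&& ~~ attached D c3, ~~ attached D c4 & ~~ attached D c5].

Definition in_P3 D c1 c3 c4 c5 :=
  [&& attached D c1, attached D c3, ~~ attached D c4 & ~~ attached D c5].

(** Three vertices of a 5-cycle are either consecutive or a rotation of the excluded [c1], [c2],
    [c4]; every set of four contains an excluded triple. *)
Lemma far_comp_type c1 c2 c3 c4 c5 D :
  hole5 c1 c2 c3 c4 c5 -> far_comp c1 c2 c3 c4 c5 D ->
  [|| in_edge D c3 c4 c5, in_edge D c4 c5 c1, in_edge D c5 c1 c2,
      in_edge D c1 c2 c3 | in_edge D c2 c3 c4] ||
  [|| in_P3 D c1 c3 c4 c5, in_P3 D c2 c4 c5 c1, in_P3 D c3 c5 c1 c2,
      in_P3 D c4 c1 c2 c3 | in_P3 D c5 c2 c3 c4].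
Proof.
move=> hC hD; have h1 := not_attached124 hC hD.
have hC2 := hole5_rot hC; have hD2 := far_comp_rot hD.
have h2 := not_attached124 hC2 hD2.
have hC3 := hole5_rot hC2; have hD3 := far_comp_rot hD2.
have h3 := not_attached124 hC3 hD3.
have hC4 := hole5_rot hC3; have hD4 := far_comp_rot hD3.
have h4 := not_attached124 hC4 hD4.
have h5 := not_attached124 (hole5_rot hC4) (far_comp_rot hD4).
move: h1 h2 h3 h4 h5; rewrite /in_edge /in_P3.
case: (attached D c1) => /=; case: (attached D c2) => /=;
case: (attached D c3) => /=; case: (attached D c4) => /=;
case: (attached D c5) => //= h1 h2 h3 h4 h5;
by [have := h1 isT isT | have := h2 isT isT | have := h3 isT isT | have := h4 isT isT | have := h5 isT isT].
Qed.

End Types.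

(** * The descent *)

Section DescentSteps.

Variable G : sgraph.
Implicit Types (a b c d x y z u v w : G).
Implicit Types (p q r s : seq G) (X Y D W Om : {set G}).

Hypothesis hG : pentagraph G.
Hypothesis hP3 : ~ exists p : seq G, P3_cutset p.
Hypothesis hP9 : ~ petersen_minus_vertex G.
Hypothesis hdeg : forall v, 2 < degree v.

Definition has_good X := exists x W, good x W /\ {subset W <= X}.

Lemma has_goodS X Y : {subset X <= Y} -> has_good X -> has_good Y.
Proof. by move=> XY [x [W [h WX]]]; exists x, W; split=> // t /WX/XY. Qed.

(* The region [Om] contains [D], which is attached to the classes of [c1] and [c2]
   only, and can be left only through neighbours of [c3], [c4] and [c5]. *)
Definition edge_descent n := forall c1 c2 c3 c4 c5 D Om,
  hole5 c1 c2 c3 c4 c5 -> far_comp c1 c2 c3 c4 c5 D -> in_edge D c3 c4 c5 ->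
  {subset D <= Om} -> #|Om| <= n ->
  (forall w, w \in Om -> ~~ [|| w -- c3, w -- c4 | w -- c5]) ->
  (forall w y, w \in Om -> w -- y -> (y \in Om) || [|| y -- c3, y -- c4 | y -- c5]) ->
  has_good Om.

Definition P3_descent n := forall c1 c2 c3 c4 c5 D,
  hole5 c1 c2 c3 c4 c5 -> far_comp c1 c2 c3 c4 c5 D -> in_P3 D c1 c3 c4 c5 ->
  #|D| <= n -> has_good D.

Lemma component_far c1 c2 c3 c4 c5 w : ~~ nbC c1 c2 c3 c4 c5 w ->
  far_comp c1 c2 c3 c4 c5 (component [set v | nbC c1 c2 c3 c4 c5 v] w).
Proof.
move=> hw; have hw' : w \notin [set v | nbC c1 c2 c3 c4 c5 v] by rewrite inE.
split.
- by exists w; apply: component_id.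
- exact: component_conn.
- by move=> v /(component_sub hw'); rewrite inE.
move=> v y hv vy; case hy: (nbC _ _ _ _ _ y); first by rewrite orbT.
by rewrite (component_closed hw' hv vy) // inE hy.
Qed.

(** As [D] is attached to [c1], an edge type must be the edge [c1 c2] or [c5 c1]. Removing from [X]
    the neighbours of the other three vertices of the hole gives a legitimate [Om]; since either of
    [c2], [c5] may be among these, exits adjacent to both are allowed. The P3 types descend inside
    [D]. The last clause of the conclusion later shows that [W] is strictly smaller than [X]. *)
Lemma descend_step n m c1 c2 c3 c4 c5 D X :
  edge_descent n -> P3_descent m ->
  hole5 c1 c2 c3 c4 c5 -> far_comp c1 c2 c3 c4 c5 D -> attached D c1 ->
  {subset D <= X} -> #|X| <= n -> #|D| <= m ->
  (forall w y, w \in X -> w -- y ->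
     [|| y \in X, y -- c3, y -- c4 | (y -- c2) && (y -- c5)]) ->
  exists x W, [/\ good x W, {subset W <= X} &
    forall w, w \in W -> ~~ (w -- c3) && ~~ (w -- c4)].
Proof.
move=> hA hJ hC hD ha DX Xn Dm hX.
have hC2 := hole5_rot hC; have hD2 := far_comp_rot hD.
have hC3 := hole5_rot hC2; have hD3 := far_comp_rot hD2.
have hC4 := hole5_rot hC3; have hD4 := far_comp_rot hD3.
have hC5 := hole5_rot hC4; have hD5 := far_comp_rot hD4.
have J : has_good D -> exists x W, [/\ good x W, {subset W <= X} &
    forall w, w \in W -> ~~ (w -- c3) && ~~ (w -- c4)].
  case=> x [W [hW WD]]; exists x, W; split=> // [t /WD/DX //|t /WD tD].
  by move: (far_off hD tD); rewrite /nbC !negb_or => /and5P[_ _ -> -> _].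
have := far_comp_type hG hP3 hP9 hC hD; case/orP.
  case/or4P => [h|/and3P[_ _]|/and3P[_]|/orP[/and3P[]|h]]; try by rewrite ha.
    pose Om := [set w in X | ~~ [|| w -- c3, w -- c4 | w -- c5]].
    have OmX : {subset Om <= X} by move=> t; rewrite inE => /andP[].
    have [] := hA _ _ _ _ _ _ Om hC hD h.
    - move=> t tD; rewrite inE DX //=.
      by move: (far_off hD tD); rewrite /nbC !negb_or => /and5P[_ _ -> -> ->].
    - by apply: leq_trans Xn; apply: subset_leq_card; apply/subsetP.
    - by move=> w; rewrite inE => /andP[].
    - move=> w y; rewrite !inE => /andP[wX _] wy.
      case/or4P: (hX _ _ wX wy) => [->|->|->|/andP[_ ->]]; rewrite ?orbT //.
      by rewrite orNb.
    move=> x [W [hW WOm]]; exists x, W; split=> // [t /WOm/OmX //|t /WOm].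
    by rewrite inE !negb_or => /and4P[_ -> -> _].
  pose Om := [set w in X | ~~ [|| w -- c2, w -- c3 | w -- c4]].
  have OmX : {subset Om <= X} by move=> t; rewrite inE => /andP[].
  have [] := hA _ _ _ _ _ _ Om hC5 hD5 h.
  - move=> t tD; rewrite inE DX //=.
    by move: (far_off hD tD); rewrite /nbC !negb_or => /and5P[_ -> -> -> _].
  - by apply: leq_trans Xn; apply: subset_leq_card; apply/subsetP.
  - by move=> w; rewrite inE => /andP[].
  - move=> w y; rewrite !inE => /andP[wX _] wy.
    case/or4P: (hX _ _ wX wy) => [->|->|->|/andP[-> _]]; rewrite ?orbT //.
    by rewrite orNb.
  move=> x [W [hW WOm]]; exists x, W; split=> // [t /WOm/OmX //|t /WOm].
  by rewrite inE !negb_or => /and4P[_ _ -> ->].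
case/or4P => [h|h|h|/orP[h|h]]; apply: J.
- exact: hJ hC hD h Dm.
- exact: hJ hC2 hD2 h Dm.
- exact: hJ hC3 hD3 h Dm.
- exact: hJ hC4 hD4 h Dm.
- exact: hJ hC5 hD5 h Dm.
Qed.

(** The far component of [w] stays in [X], because every exit from [X] is near the hole, and [f]
    attaches it to [c1]. It misses [f], which saves one vertex when [f] lies in [X]. *)
Lemma descend n m c1 c2 c3 c4 c5 f w X :
  edge_descent n -> P3_descent m -> hole5 c1 c2 c3 c4 c5 ->
  f -- c1 -> f -- w -> ~~ nbC c1 c2 c3 c4 c5 w -> w \in X -> #|X| <= n ->
  #|X| <= m \/ f \in X /\ #|X| <= m.+1 ->
  (forall w y, w \in X -> w -- y ->
     [|| y \in X, y -- c3, y -- c4 | (y -- c2) && (y -- c5)]) ->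
  exists x W, [/\ good x W, {subset W <= X} &
    forall w, w \in W -> ~~ (w -- c3) && ~~ (w -- c4)].
Proof.
move=> hA hJ hC fc fw nw wX Xn Xm hX.
have hD := component_far nw; set D := component _ _ in hD.
have fD : f \notin D by apply/negP=> /(far_off hD); rewrite /nbC fc.
have DX : {subset D <= X}.
  move=> t; rewrite inE; apply: (connect_invariant (S := fun t => t \in X)) => //.
  move=> u v uX /and3P[_]; rewrite inE => nv uv.
  move: nv; rewrite /nbC !negb_or => /and5P[_ v2 v3 v4 v5].
  by case/or4P: (hX _ _ uX uv) => // [h|h|/andP[h _]];
    [rewrite h in v3 | rewrite h in v4 | rewrite h in v2].
apply: (descend_step hA hJ hC hD _ DX Xn _ hX).
  apply/attachedP; exists f => //; apply/touchesP; exists w => //.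
  exact: component_id.
case: Xm => [Xm|[fX Xm]].
  by apply: leq_trans Xm; apply: subset_leq_card; apply/subsetP.
rewrite -ltnS; apply: leq_trans Xm; apply: proper_card; apply/properP.
by split; [apply/subsetP | exists f].
Qed.

(** All exits from [D] are neighbours of [c1], and the neighbour [c2] of [c1] does not touch [D]. *)
Lemma good_single c1 c2 c3 c4 c5 D :
  hole5 c1 c2 c3 c4 c5 -> far_comp c1 c2 c3 c4 c5 D ->
  ~~ attached D c2 -> in_edge D c3 c4 c5 -> good c1 D.
Proof.
move=> hC hD n2 /and3P[n3 n4 n5]; have E := hole5E hG hC; split.
- exact: far_n0 hD.
- exact: far_conn hD.
- move=> w wD; have := far_off hD wD; rewrite /nbC !negb_or => /and5P[h _ _ _ _].
  rewrite adjC h andbT; apply/eqP=> e; have := far_off hD wD.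
  by rewrite e (nbC_hole hG) // mem_head.
- move=> w y wD wy; have ty : touches D y by apply: (touchesI wD); rewrite adjC.
  have key c : y -- c -> ~~ attached D c -> False.
    by move=> yc /negP; apply; apply/attachedP; exists y.
  case/orP: (far_closed hD wD wy) => [->//|].
  rewrite /nbC => /or4P[h|h|h|/orP[h|h]].
  + by rewrite [c1 -- y]adjC h orbT.
  + by case: (key _ h n2).
  + by case: (key _ h n3).
  + by case: (key _ h n4).
  + by case: (key _ h n5).
exists c2; first by rewrite E.
apply/touchesP=> -[w wD]; rewrite adjC => h.
by move: (far_off hD wD); rewrite /nbC h orbT.
Qed.

(** The hole is changed to [a c1 c2 c3 b]. Exits from [D] in the class of [c1] are adjacent to [b]
    by [dist2_adj], so [D] itself can serve as the region. If the neighbour [f] of [a] has no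
    neighbour far from the new hole, it has one in the class of [c3]; that vertex is adjacent to
    [a], a triangle. *)
Lemma P3_descentS n : edge_descent n.+1 -> P3_descent n -> P3_descent n.+1.
Proof.
move=> hA hJ c1 c2 c3 c4 c5 D hC hD hT Dn.
case/and4P: (hT) => /attachedP[a ac ta] /attachedP[b bc tb] n4 n5.
have ab := dist2_adj hG hC hD ta tb ac bc.
have E := hole5E hG hC.
have Ea := one_nbr hG hC (touches_off hD ta) ac.
have Eb := one_nbr3 hG hC (touches_off hD tb) bc.
have hC' : hole5 a c1 c2 c3 b.
  rewrite /hole5 /= !inE !(E, Ea, Eb) [b -- a]adjC ab (negbTE (adj_neq ab)) //=.
case/touchesP: (ta) => f fD af.
have fa : f -- a by rewrite adjC.
have nf c : c \in [:: c1; c2; c3; c4; c5] -> (f == c) = false.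
  move=> cC; apply/eqP=> e; have := far_off hD fD; by rewrite e nbC_hole.
have fna : (f == a) = false.
  by apply/eqP=> e; have := far_off hD fD; rewrite e /nbC ac.
have fnb : (f == b) = false.
  by apply/eqP=> e; have := far_off hD fD; rewrite e /nbC bc !orbT.
have fC' : f \notin [:: a; c1; c2; c3; b].
  by rewrite !inE fna fnb !nf // !inE ?eqxx ?orbT.
have nD w y : w \in D -> w -- y -> [|| y \in D, y -- c2, y -- c3 | (y -- c1) && (y -- b)].
  move=> wD wy; have ty : touches D y by apply: (touchesI wD); rewrite adjC.
  case/orP: (far_closed hD wD wy) => [->//|].
  rewrite /nbC => /or4P[h|h|h|/orP[h|h]]; rewrite ?h ?orbT //.
  - by rewrite (dist2_adj hG hC hD ty tb h bc) !orbT.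
  - by case/negP: n4; apply/attachedP; exists y.
  - by case/negP: n5; apply/attachedP; exists y.
case: (boolP [exists w, (f -- w) && ~~ nbC a c1 c2 c3 b w]).
  case/existsP=> w /andP[fw nw].
  have wD : w \in D.
    move: nw; rewrite /nbC !negb_or => /and5P[_ v2 v3 v4 v5].
    by case/or4P: (nD _ _ fD fw) => // [h|h|/andP[h _]];
      [rewrite h in v3 | rewrite h in v4 | rewrite h in v2].
  have [|x [W [hW WD _]]] := descend hA hJ hC' fa fw nw wD Dn _ nD.
    by right.
  by exists x, W.
rewrite negb_exists => /forallP hf.
have [|_ [u fu uc]] := near_nbrs hG hC' (hdeg f) fC' fa.
  by move=> w fw; have := hf w; rewrite fw /= negbK.
have tu : touches D u by apply: (touchesI fD); rewrite adjC.
have au := dist2_adj hG hC hD ta tu ac uc.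
by case: (no_triangle hG af fu); rewrite adjC.
Qed.

Lemma class12_nadj c1 c2 c3 c4 c5 a b : hole5 c1 c2 c3 c4 c5 ->
  a \notin [:: c1; c2; c3; c4; c5] -> b \notin [:: c1; c2; c3; c4; c5] ->
  a -- c1 -> b -- c2 -> (a != b) && ~~ a -- b.
Proof.
move=> hC aC bC ac bc; have E := hole5E hG hC.
have Ea := one_nbr hG hC aC ac; have Eb := one_nbr2 hG hC bC bc.
apply/andP; split; first by apply/eqP=> e; move: bc; rewrite -e Ea.
by apply/negP=> h; apply: (@no_square _ hG a c1 c2 b); rewrite ?(E, Ea, Eb) // adjC.
Qed.

(* If [a r b] is a path of length two through [D], the 5-cycle [r a c1 c2 b]
   and a third neighbour [s] of [r] give a descent, or a path [s1 s r b]. *)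
Lemma even_crossing n c1 c2 c3 c4 c5 D b :
  edge_descent n -> P3_descent n ->
  hole5 c1 c2 c3 c4 c5 -> far_comp c1 c2 c3 c4 c5 D -> in_edge D c3 c4 c5 ->
  #|D| <= n -> ~ has_good D -> touches D b -> b -- c2 ->
  exists a q, [/\ a -- c1, touches D a, chordless (a :: rcons q b),
    q != [::] & {subset q <= D} /\ ~~ odd (size q)].
Proof.
move=> hA hJ hC hD hT Dn ng tb bc; have E := hole5E hG hC.
case/and3P: (hT) => n3 n4 n5.
have bC := touches_off hD tb.
(* Without such an [a], the component is attached to [c2] alone and [good_single] applies. *)
have [a ac ta] : exists2 a, a -- c1 & touches D a.
  apply/attachedP; apply: contraT => n1; case: ng; exists c2, D; split=> //.
  apply: (good_single (hole5_rot hC) (far_comp_rot hD)) => //.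
  by rewrite /in_edge n4 n5 n1.
have aC := touches_off hD ta.
have /andP[ab nab] := class12_nadj hC aC bC ac bc.
have [q [hq q0 qD]] := conn_chordless (far_conn hD) ta tb ab nab.
case oq: (odd (size q)); last by exists a, q; rewrite oq.
have := crossing_odd hG hC hD ac bc ta tb hq q0 qD oq.
case: q hq q0 qD {oq} => [|r []] // hq _ qD _.
have rD : r \in D by apply: qD; rewrite mem_head.
have [ar rb] : a -- r /\ r -- b by move: hq; rewrite /= => /andP[-> /and3P[_ _ /andP[->]]].
have Ea := one_nbr hG hC aC ac; have Eb := one_nbr2 hG hC bC bc.
have aD := touches_notin hD ta; rewrite /nbC ac /= in aD; have {}aD := aD isT.
have bD := touches_notin hD tb; rewrite /nbC bc orbT /= in bD; have {}bD := bD isT.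
have far_nc t c : t \in D -> c \in [:: c1; c2; c3; c4; c5] ->
    ((t == c) = false) * ((t -- c) = false) * ((c -- t) = false).
  move=> tD cC; have h : anticomplete [:: t] [:: c].
    by apply: (far_anti hG hC hD) => u; rewrite inE => /eqP->.
  have [ne na] := h t c (mem_head _ _) (mem_head _ _).
  by rewrite [c -- t]adjC (negbTE ne) (negbTE na).
have in1 : c1 \in [:: c1; c2; c3; c4; c5] by rewrite !inE eqxx.
have in2 : c2 \in [:: c1; c2; c3; c4; c5] by rewrite !inE eqxx orbT.
have hC' : hole5 r a c1 c2 b.
  rewrite /hole5 /= !inE !(E, Ea, Eb, far_nc r c1, far_nc r c2) // [r -- a]adjC ar [b -- r]adjC rb.
  by rewrite (negbTE (adj_neq rb)) (negbTE ab) eq_sym (negbTE (adj_neq ar)).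
have [s [rs sa sb]] : exists s : G, [/\ r -- s, s != a & s != b].
  have [u [w [ru rw uw ua wa]]] := degree_gt2 a (hdeg r).
  case: (eqVneq u b) => [ub|ub]; last by exists u.
  by exists w; split=> //; rewrite -ub eq_sym.
have nD w y : w \in D -> w -- y -> [|| y \in D, y -- c1 | y -- c2].
  move=> wD wy; have ty : touches D y by apply: (touchesI wD); rewrite adjC.
  case/orP: (far_closed hD wD wy) => [->//|].
  rewrite /nbC => /or4P[h|h|h|/orP[h|h]]; rewrite ?h ?orbT //.
  - by case/negP: n3; apply/attachedP; exists y.
  - by case/negP: n4; apply/attachedP; exists y.
  - by case/negP: n5; apply/attachedP; exists y.
have sr : s -- r by rewrite adjC.
have sD : s \in D.
  case/or3P: (nD _ _ rD rs) => [//|h|h].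
    move/eqP: sa; case; apply: (@common_nbr _ hG c1 r) => //.
    - by rewrite eq_sym far_nc.
    - by rewrite adjC.
    - by rewrite adjC.
    - by rewrite adjC.
  move/eqP: sb; case; apply: (@common_nbr _ hG c2 r) => //.
  - by rewrite eq_sym far_nc.
  - by rewrite adjC.
  - by rewrite adjC.
have sC' : s \notin [:: r; a; c1; c2; b].
  by rewrite !inE (far_nc s c1) // (far_nc s c2) // (negbTE sa) (negbTE sb) (negbTE (adj_neq sr)).
case: (boolP [exists w, (s -- w) && ~~ nbC r a c1 c2 b w]).
  case/existsP=> w /andP[sw nw]; case: ng.
  have wD : w \in D.
    move: nw; rewrite /nbC !negb_or => /and5P[_ _ v1 v2 _].
    by case/or3P: (nD _ _ sD sw) => // h; [rewrite h in v1 | rewrite h in v2].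
  have [|u v uD uv|x [W [hW WD _]]] := descend hA hJ hC' sr sw nw wD Dn.
  - by left.
  - by case/or3P: (nD _ _ uD uv) => ->; rewrite ?orbT.
  by exists x, W.
rewrite negb_exists => /forallP hf.
(* In the hole [r a c1 c2 b] the class opposite to [r] used here is that of [c1]. *)
have [|[a' sa' ac'] _] := near_nbrs hG hC' (hdeg s) sC' sr.
  by move=> w sw; have := hf w; rewrite sw /= negbK.
have ta' : touches D a' by apply: (touchesI sD); rewrite adjC.
have aC' := touches_off hD ta'.
have /andP[ab' nab'] := class12_nadj hC aC' bC ac' bc.
have aD' := touches_notin hD ta'; rewrite /nbC ac' /= in aD'; have {}aD' := aD' isT.
have a's : a' -- s by rewrite adjC.
exists a', [:: s; r]; split=> //; last first.
  by split=> // t; rewrite !inE => /orP[]/eqP->.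
have a'r : (a' == r) = false by apply/eqP=> e; rewrite e rD in aD'.
have na'r : (a' -- r) = false by apply/negP=> h; apply: (no_triangle hG h rs).
have nsb : (s -- b) = false.
  by apply/negP=> h; apply: (@no_triangle _ hG s b r); rewrite // adjC.
rewrite /= !inE a's sr rb a'r na'r nsb (negbTE ab') (negbTE nab') (negbTE sb).
by rewrite (negbTE (adj_neq a's)) (negbTE (adj_neq sr)) (negbTE (adj_neq rb)).
Qed.

(* The two even paths [q] and [q'] would make [a q b q' d], closed up by [a d] or
   by [c3 c4 c5 c1], an odd hole. *)
Lemma two_crossings c1 c2 c3 c4 c5 D D' a b d q q' :
  hole5 c1 c2 c3 c4 c5 -> far_comp c1 c2 c3 c4 c5 D -> far_comp c1 c2 c3 c4 c5 D' ->
  ~~ attached D c3 -> ~~ attached D' c1 ->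
  a -- c1 -> b -- c2 -> d -- c3 -> touches D a -> touches D b -> touches D' d ->
  chordless (a :: rcons q b) -> {subset q <= D} -> ~~ odd (size q) -> q != [::] ->
  chordless (b :: rcons q' d) -> {subset q' <= D'} -> ~~ odd (size q') -> q' != [::] ->
  False.
Proof.
move=> hC hD hD' n3 n1 ac bc dc ta tb td hq qD eq q0 hq' qD' eq' q0'.
have E := hole5E hG hC.
have aC := touches_off hD ta; have bC := touches_off hD tb; have dC := touches_off hD' td.
have Ea := one_nbr hG hC aC ac; have Eb := one_nbr2 hG hC bC bc.
have Ed := one_nbr3 hG hC dC dc.
have naD' t : t \in D' -> ~~ a -- t.
  move=> tD'; apply: contra n1 => h; apply/attachedP; exists a => //.
  exact: touchesI tD' h.
have ndD t : t \in D -> ~~ d -- t.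
  move=> tD; apply: contra n3 => h; apply/attachedP; exists d => //.
  exact: touchesI tD h.
(* The components differ because [a] touches [D], whereas [D'] is not attached to the class of
   [a]. *)
have disj t : t \in D -> t \notin D'.
  move=> tD; apply/negP=> tD'; case/touchesP: ta => u uD au.
  have: u \in D'.
    have := far_conn hD tD uD.
    apply: (connect_invariant (S := fun t => t \in D')) => // v w vD' /and3P[_ wD vw].
    by case/orP: (far_closed hD' vD' vw) => //; rewrite (negbTE (far_off hD wD)).
  by move/naD'; rewrite au.
have DD' (s t : G) : s \in D -> t \in D' -> s != t /\ ~~ s -- t.
  move=> sD tD'; split; first by apply: contraNneq (disj _ sD) => ->.
  apply/negP=> st; case/orP: (far_closed hD sD st) => [/disj|].
    by rewrite tD'.
  by rewrite (negbTE (far_off hD' tD')).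
have aD' : a \notin D' by apply/negP=> /(far_off hD'); rewrite /nbC ac.
have dD : d \notin D by apply/negP=> /(far_off hD); rewrite /nbC dc !orbT.
have /andP[ab nab] := class12_nadj hC aC bC ac bc.
have ad : a != d by apply/eqP=> e; move: dc; rewrite -e Ea.
have sq : 1 < size q by move: eq q0; case: (q) => [|? []].
have sq' : 1 < size q' by move: eq' q0'; case: (q') => [|? []].
have an0 (s t : G) : s \in a :: q -> t \in q' -> s != t /\ ~~ s -- t.
  rewrite inE => /orP[/eqP->|/qD sD] /qD' tD'; last exact: DD'.
  by split; [apply: contraNneq aD' => -> | apply: naD'].
have hdb : chordless (d :: rcons (rev q') b).
  by have := chordless_rev hq'; rewrite rev_cons rev_rcons rcons_cons.
have dn0 t : t \in q -> t != d /\ ~~ t -- d.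
  move=> /qD tD; split; last by rewrite adjC; apply: ndD.
  by apply: contraNneq dD => <-.
case nad: (a -- d).
  have h2 : chordless (a :: rcons (d :: rev q') b).
    rewrite rcons_cons chordless_cons; apply/and4P; split=> //.
      rewrite inE negb_or ad mem_rcons inE negb_or ab mem_rev.
      by apply: contra aD' => /qD'.
    rewrite all_rcons nab all_rev.
    by apply/allP=> t tq; case: (an0 a t (mem_head _ _) tq).
  have an : anticomplete q (d :: rev q').
    move=> u t uq; rewrite inE mem_rev => /orP[/eqP->|tq]; first exact: dn0.
    by apply: an0 => //; rewrite inE uq orbT.
  have := glue_odd hG hq h2 q0 isT an.
  rewrite /= size_rev addnS /= oddD (negbTE eq) (negbTE eq') => /(_ isT) [] e.
  by have := leq_add sq sq'; rewrite e.
have hp : chordless (a :: rcons (q ++ b :: q') d).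
  have -> : a :: rcons (q ++ b :: q') d = (a :: q) ++ b :: rcons q' d.
    by rewrite rcons_cat.
  apply: chordless_cat => // u t ua; rewrite mem_rcons !inE => /orP[/eqP->|tq].
    by move: ua; rewrite inE => /orP[/eqP->|/dn0//]; rewrite nad.
  exact: an0.
have h2 : chordless (a :: rcons [:: c1; c5; c4; c3] d).
  by rewrite /= !inE ?(E, Ea, Ed) (negbTE ad) nad.
have an : anticomplete (q ++ b :: q') [:: c1; c5; c4; c3].
  have sub : {subset [:: c1; c5; c4; c3] <= [:: c1; c2; c3; c4; c5]}.
    by move=> t; rewrite !inE => /or4P[] /eqP->; rewrite eqxx ?orbT.
  move=> u t; rewrite mem_cat inE => /or3P[uq|/eqP->|uq] tC.
  - exact: (far_anti hG hC hD qD sub).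
  - by move: tC; rewrite !inE => /or4P[] /eqP->; rewrite !Eb.
  - exact: (far_anti hG hC hD' qD' sub).
have ne : q ++ b :: q' != [::] by case: (q).
have := glue_odd hG hp h2 ne isT an; rewrite size_cat /= !addnS /=.
by rewrite addn0 oddD !negbK (negbTE eq) (negbTE eq') => /(_ isT).
Qed.

End DescentSteps.

Section Descent.

Variable G : sgraph.
Implicit Types (a b c d x y z u v w : G).
Implicit Types (p q r s : seq G) (X Y D W Om : {set G}).

Hypothesis hG : pentagraph G.
Hypothesis hP3 : ~ exists p : seq G, P3_cutset p.
Hypothesis hP9 : ~ petersen_minus_vertex G.
Hypothesis hdeg : forall v, 2 < degree v.

Lemma component_adj X v w : v \notin X -> w \notin X -> v -- w ->
  component X w = component X v.
Proof.
move=> vX wX vw; apply/setP=> t; rewrite !inE.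
apply: same_connect; first exact: del_adj_sym.
by apply: connect1; rewrite /del_adj /= wX vX adjC.
Qed.

(** * The inductive step for components attached to an edge *)

Section EdgeStep.

Variable n : nat.
Hypothesis hA : edge_descent G n.
Hypothesis hJ : P3_descent G n.

(** A failure of the edge descent at size [n.+1]. The component [D] is forgotten, which makes the
    situation symmetric under exchanging [c1] with [c2] and [c3] with [c5]. By [stuck_near], each
    far component inside [Om] misses a vertex of [Om], so the induction hypotheses apply to it. *)
Record stuck c1 c2 c3 c4 c5 Om : Prop := Stuck {
  stuck_hole : hole5 c1 c2 c3 c4 c5;
  stuck_off : forall w, w \in Om -> ~~ [|| w -- c3, w -- c4 | w -- c5];
  stuck_closed : forall w y, w \in Om -> w -- y ->
    (y \in Om) || [|| y -- c3, y -- c4 | y -- c5];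
  stuck_card : #|Om| <= n.+1;
  stuck_near : exists2 a, a \in Om & nbC c1 c2 c3 c4 c5 a;
  stuck_bad : ~ has_good Om }.

Lemma hole5_flip c1 c2 c3 c4 c5 : hole5 c1 c2 c3 c4 c5 -> hole5 c2 c1 c5 c4 c3.
Proof. by move/hole5_rev/hole5_rot/hole5_rot/hole5_rot. Qed.

Lemma nbC_flip c1 c2 c3 c4 c5 v : nbC c2 c1 c5 c4 c3 v = nbC c1 c2 c3 c4 c5 v.
Proof.
by rewrite /nbC; case: (v -- c1) (v -- c2) (v -- c3) (v -- c4) (v -- c5) => [] [] [] [] [].
Qed.

Lemma or3_flip (a b c : bool) : [|| c, b | a] = [|| a, b | c].
Proof. by case: a b c => [] [] []. Qed.

Lemma stuck_flip c1 c2 c3 c4 c5 Om :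
  stuck c1 c2 c3 c4 c5 Om -> stuck c2 c1 c5 c4 c3 Om.
Proof.
case=> h1 h2 h3 h4 [a h5 h6] h7; split=> //.
- exact: hole5_flip.
- by move=> w; rewrite (or3_flip (w -- c3)); apply: h2.
- by move=> w y; rewrite (or3_flip (y -- c3)); apply: h3.
- by exists a; rewrite // nbC_flip.
Qed.

(** Collects all far components in [Om] attached within the edge [c1 c2], not only the initial
    one. *)
Definition edge_vertex c1 c2 c3 c4 c5 Om v :=
  [&& v \in Om, ~~ nbC c1 c2 c3 c4 c5 v &
    in_edge (component [set u | nbC c1 c2 c3 c4 c5 u] v) c3 c4 c5].

Lemma edge_vertex_flip c1 c2 c3 c4 c5 Om v :
  edge_vertex c2 c1 c5 c4 c3 Om v = edge_vertex c1 c2 c3 c4 c5 Om v.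
Proof.
rewrite /edge_vertex nbC_flip /in_edge.
have -> : [set u | nbC c2 c1 c5 c4 c3 u] = [set u | nbC c1 c2 c3 c4 c5 u].
  by apply/setP=> u; rewrite !inE nbC_flip.
congr (_ && (_ && _)).
by case: (attached _ c3) (attached _ c4) (attached _ c5) => [] [] [].
Qed.

Section Stuck.

Variables (c1 c2 c3 c4 c5 : G) (Om : {set G}).
Hypothesis hS : stuck c1 c2 c3 c4 c5 Om.
Let hC := stuck_hole hS.
Let E := hole5E hG hC.
Notation C := [:: c1; c2; c3; c4; c5].
Notation near := (nbC c1 c2 c3 c4 c5).
Notation cmp v := (component [set u | nbC c1 c2 c3 c4 c5 u] v).
Notation ev := (edge_vertex c1 c2 c3 c4 c5 Om).

Lemma cmp_sub v : v \in Om -> ~~ near v -> {subset cmp v <= Om}.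
Proof.
move=> vO nv t; rewrite inE.
apply: (connect_invariant (S := fun t => t \in Om)) => // u w uO /and3P[_].
rewrite inE => nw uw; case/orP: (stuck_closed hS uO uw) => // h; case/negP: nw.
by rewrite /nbC; case/or3P: h => ->; rewrite !orbT.
Qed.

Lemma stuck_comp_card D : far_comp c1 c2 c3 c4 c5 D -> {subset D <= Om} -> #|D| <= n.
Proof.
move=> hD DO; have [a aO na] := stuck_near hS.
rewrite -ltnS; apply: leq_trans (stuck_card hS); apply: proper_card; apply/properP.
split; first by apply/subsetP.
by exists a => //; apply/negP=> /(far_off hD); rewrite na.
Qed.

Lemma stuck_comp_bad D : {subset D <= Om} -> ~ has_good D.
Proof. by move=> DO h; apply: (stuck_bad hS); apply: has_goodS h. Qed.

(** Any P3 type would give a good pair inside [Om], and [v] rules out the edges that avoid [c2]. *)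
Lemma stuck_type D v : far_comp c1 c2 c3 c4 c5 D -> {subset D <= Om} ->
  touches D v -> v -- c2 -> in_edge D c3 c4 c5 || in_edge D c4 c5 c1.
Proof.
move=> hD DO tv vc; have Dn := stuck_comp_card hD DO; have ng := stuck_comp_bad DO.
have hC2 := hole5_rot hC; have hD2 := far_comp_rot hD.
have hC3 := hole5_rot hC2; have hD3 := far_comp_rot hD2.
have hC4 := hole5_rot hC3; have hD4 := far_comp_rot hD3.
have hC5 := hole5_rot hC4; have hD5 := far_comp_rot hD4.
have t2 : attached D c2 by apply/attachedP; exists v.
case/orP: (far_comp_type hG hP3 hP9 hC hD).
  case/or4P => [->//|->|/and3P[_ _]|/orP[/and3P[_]|/and3P[]]]; rewrite ?orbT // t2 //.
case/or4P => [h|h|h|/orP[h|h]]; case: ng.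
- exact: hJ hC hD h Dn.
- exact: hJ hC2 hD2 h Dn.
- exact: hJ hC3 hD3 h Dn.
- exact: hJ hC4 hD4 h Dn.
- exact: hJ hC5 hD5 h Dn.
Qed.

Lemma ev_comp v : ev v -> [/\ far_comp c1 c2 c3 c4 c5 (cmp v),
  in_edge (cmp v) c3 c4 c5, {subset cmp v <= Om} & v \in cmp v].
Proof.
case/and3P=> vO nv h; split=> //; [exact: component_far|exact: cmp_sub|exact: component_id].
Qed.

Lemma ev_adj v w : ev v -> v -- w -> ~~ near w -> ev w.
Proof.
move=> hv vw nw; have [hD hT DO vD] := ev_comp hv; case/and3P: hv => vO nv _.
have nv' : v \notin [set u | near u] by rewrite inE.
have nw' : w \notin [set u | near u] by rewrite inE.
have wD := component_closed nv' vD vw nw'.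
by rewrite /edge_vertex (DO _ wD) nw (component_adj nv' nw' vw).
Qed.

Lemma ev_near v w : ev v -> v -- w -> near w -> (w \notin C) && ((w -- c1) || (w -- c2)).
Proof.
move=> hv vw nw; have [hD /and3P[n3 n4 n5] _ vD] := ev_comp hv.
have tw : touches (cmp v) w by apply: (touchesI vD); rewrite adjC.
rewrite (touches_off hD tw) /=; move: nw; rewrite /nbC.
case/or4P=> [->//|->|h|/orP[h|h]]; rewrite ?orbT //.
- by case/negP: n3; apply/attachedP; exists w.
- by case/negP: n4; apply/attachedP; exists w.
- by case/negP: n5; apply/attachedP; exists w.
Qed.

(** A far [y] whose component is attached to the edge [c2 c3] would supply a second even path from
    [v], against [two_crossings]. A near [y] in class five contradicts [even_crossing_no5]; the
    other classes give short cycles. *)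
Lemma ev_class2_nbr v w y : ev w -> v -- w -> v -- c2 -> v -- y ->
  [|| y == c2, ev y | (y \notin C) && (y -- c4)].
Proof.
move=> hw vw vc vy; have [hD hT DO wD] := ev_comp hw.
have tv : touches (cmp w) v by apply: (touchesI wD).
have vC := touches_off hD tv; have Ev := one_nbr2 hG hC vC vc.
have vO : v \in Om.
  have wv : w -- v by rewrite adjC.
  by have := stuck_closed hS (DO _ wD) wv; rewrite !Ev !orbF.
have [a [q [ac ta hq q0 [qD eq]]]] := even_crossing hG hP3 hP9 hdeg hA hJ hC hD hT
  (stuck_comp_card hD DO) (stuck_comp_bad DO) tv vc.
case/and3P: (hT) => n3 n4 n5.
case: (boolP (near y)) => ny; last first.
  apply/or3P; apply: Or32.
  have yO : y \in Om.
    case/orP: (stuck_closed hS vO vy) => // h; case/negP: ny.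
    by rewrite /nbC; case/or3P: h => ->; rewrite !orbT.
  rewrite /edge_vertex yO ny /=; have hD' := component_far ny.
  have DO' := cmp_sub yO ny; have yD' : y \in cmp y := component_id _ _.
  have tv' : touches (cmp y) v := touchesI yD' vy.
  case/orP: (stuck_type hD' DO' tv' vc) => // hT'; exfalso.
  have hD3 := far_comp_rot (far_comp_rot (far_comp_rot (far_comp_rev hD'))).
  have hC3 := hole5_rot (hole5_rot (hole5_rot (hole5_rev hC))).
  have hD2 := far_comp_rot (far_comp_rot (far_comp_rev hD')).
  have hC2 := hole5_rot (hole5_rot (hole5_rev hC)).
  have hT2 : in_edge (cmp y) c1 c5 c4.
    by move: hT'; rewrite /in_edge => /and3P[-> -> ->].
  have [d [q' [dc td hq' q0' [qD' eq']]]] := even_crossing hG hP3 hP9 hdeg hA hJ hC2 hD2 hT2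
    (stuck_comp_card hD' DO') (stuck_comp_bad DO') tv' vc.
  have n1 : ~~ attached (cmp y) c1 by case/and3P: hT'.
  apply: (two_crossings hG hC hD hD' n3 n1 ac vc dc ta tv td hq qD eq q0 (q' := rev q')).
  - by have := chordless_rev hq'; rewrite rev_cons rev_rcons rcons_cons.
  - by move=> t; rewrite mem_rev; apply: qD'.
  - by rewrite size_rev.
  - by rewrite -size_eq0 size_rev size_eq0.
case: (boolP (y \in C)) => yC.
  move: yC; rewrite !inE => /or4P[/eqP h|->//|/eqP h|/orP[]/eqP h];
    by move: vy; rewrite h Ev.
have nvy c : v -- c -> y -- c -> False.
  by move=> h1 h2; apply: (@no_triangle _ hG v y c); rewrite // adjC.
move: ny; rewrite /nbC => /or4P[h|h|h|/orP[h|h]].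
- have := class12_nadj hG hC yC vC h vc.
  by rewrite [y -- v]adjC vy andbF.
- by case: (nvy c2).
- have yC' := notin_rot yC; have vC' := notin_rot vC.
  by have := class12_nadj hG (hole5_rot hC) vC' yC' vc h; rewrite vy andbF.
- by rewrite h !orbT.
exfalso; apply: (even_crossing_no5 hG hC hD ac vc ta tv hq q0 qD eq yC h) vy.
by apply: contra n5 => ty; apply/attachedP; exists y.
Qed.

(** Without a jump from class two to class four, the component of [w0] outside [N[c1]] stays among
    edge vertices and their neighbours of class two. It therefore stays in [Om] and misses the
    neighbours of [c5], so it is good with centre [c1]. *)
Lemma ev_jump w0 : ev w0 ->
  exists v w m, [/\ ev w, v -- w, v -- c2, m \notin C & m -- c4 /\ v -- m].
Proof.
move=> h0; apply: NNPP => hno; apply: (stuck_bad hS).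
have [hD hT DO w0D] := ev_comp h0.
pose S v := ev v \/ v -- c2 /\ exists2 w, ev w & v -- w.
pose X := [set v | (v == c1) || (v -- c1)].
have w0X : w0 \notin X.
  rewrite inE negb_or; have := far_off hD w0D; rewrite /nbC negb_or => /andP[-> _].
  rewrite andbT; apply/eqP=> e; have := far_off hD w0D.
  by rewrite e (nbC_hole hG hC) // mem_head.
have WS v : v \in component X w0 -> S v.
  rewrite inE; apply: connect_invariant; last by left.
  move=> {}v y [hv|[vc [w hw vw]]] /and3P[_]; rewrite !inE negb_or => /andP[yc1 nyc] vy.
    case: (boolP (near y)) => ny; last by left; apply: ev_adj vy ny.
    case/andP: (ev_near hv vy ny) => _; rewrite (negbTE nyc) /= => yc2.
    by right; split=> //; exists v; rewrite // adjC.
  case/or3P: (ev_class2_nbr hw vw vc vy) => [/eqP e|hy|/andP[yC yc]].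
  - by move: nyc; rewrite e E.
  - by left.
  - by case: hno; exists v, w, y.
have class2 v : v -- c2 -> (exists2 w, ev w & v -- w) -> v \in Om /\ (v -- c5) = false.
  move=> vc [w hw vw]; have [hD' _ DO' wD'] := ev_comp hw.
  have tv : touches (cmp w) v by apply: (touchesI wD').
  have Ev := one_nbr2 hG hC (touches_off hD' tv) vc.
  have wv : w -- v by rewrite adjC.
  by have := stuck_closed hS (DO' _ wD') wv; rewrite !Ev !orbF.
have WX := component_sub w0X.
exists c1, (component X w0); split; last first.
  by move=> v /WS [/and3P[]//|[vc h]]; case: (class2 v vc h).
split.
- by exists w0; apply: component_id.
- exact: component_conn.
- by move=> w /WX; rewrite inE negb_or [c1 -- w]adjC.
- move=> w y wW wy; case: (boolP (y \in X)) => [|yX].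
    rewrite inE => /orP[/eqP e|]; last by rewrite adjC => ->; rewrite orbT.
    by have := WX _ wW; rewrite inE -e wy orbT.
  by rewrite (component_closed w0X wW wy yX).
exists c5; first by rewrite E.
apply/touchesP=> -[v /WS hv c5v]; rewrite adjC in c5v.
case: hv => [/and3P[_]|[vc h]]; first by rewrite /nbC c5v !orbT.
by case: (class2 v vc h) => _; rewrite c5v.
Qed.

End Stuck.

End EdgeStep.

(** Jumps exist from both classes and, by [jumps_share], land on the same vertex [m]. This gives the
    5-hole [n2 c2 c1 n1 m]. Either the descent continues from it in a smaller region, or the
    neighbours forced by the degree condition build the Petersen graph minus a vertex. *)
Lemma edge_descentS n : edge_descent G n -> P3_descent G n -> edge_descent G n.+1.
Proof.
move=> hA hJ c1 c2 c3 c4 c5 D Om hC hD hT DO On offO clO; apply: NNPP => ng.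
have E := hole5E hG hC.
have [a ac ta] : exists2 a, a -- c1 & touches D a.
  apply/attachedP; apply: contraT => n1; case: ng; exists c2, D; split=> //.
  apply: (good_single hG (hole5_rot hC) (far_comp_rot hD)).
    by case/and3P: hT.
  by case/and3P: hT => _ n4 n5; rewrite /in_edge n4 n5 n1.
have Ea := one_nbr hG hC (touches_off hD ta) ac.
have hS : stuck n c1 c2 c3 c4 c5 Om.
  split=> //; exists a; last by rewrite /nbC ac.
  case/touchesP: ta => w wD; rewrite adjC => wa.
  by have := clO _ _ (DO _ wD) wa; rewrite !Ea !orbF.
have hS' := stuck_flip hS.
have [w0 ev0] : exists w0, edge_vertex c1 c2 c3 c4 c5 Om w0.
  have [w0 w0D] := far_n0 hD; exists w0.
  have nw0 := far_off hD w0D; rewrite /edge_vertex (DO _ w0D) nw0 /=.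
  have sub : {subset component [set u | nbC c1 c2 c3 c4 c5 u] w0 <= D}.
    move=> t; rewrite inE; apply: (connect_invariant (S := fun t => t \in D)) => //.
    move=> u v uD /and3P[_]; rewrite inE => nv uv.
    by case/orP: (far_closed hD uD uv) => //; rewrite (negbTE nv).
  have mono c : ~~ attached D c -> ~~ attached (component [set u | nbC c1 c2 c3 c4 c5 u] w0) c.
    apply: contra => /attachedP[y yc /touchesP[t /sub tD yt]].
    by apply/attachedP; exists y => //; apply: touchesI yt.
  by case/and3P: hT => n3 n4 n5; rewrite /in_edge !mono.
have [n2 [w2 [m [hw2 nw2 nc2 mC [mc nm2]]]]] := ev_jump hA hJ hS ev0.
rewrite -edge_vertex_flip in ev0.
have [n1 [w1 [m' [hw1 nw1 nc1 mC' [mc' nm1]]]]] := ev_jump hA hJ hS' ev0.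
have flipC t : (t \in [:: c2; c1; c5; c4; c3]) = (t \in [:: c1; c2; c3; c4; c5]).
  by rewrite !inE; case: (t == c1) (t == c2) (t == c3) (t == c4) (t == c5) => [] [] [] [] [].
rewrite flipC in mC'; rewrite edge_vertex_flip in hw1.
have attC v w : edge_vertex c1 c2 c3 c4 c5 Om w -> v -- w ->
   (v -- c1) || (v -- c2) -> v \notin [:: c1; c2; c3; c4; c5] /\ v \in Om.
  move=> hw vw h; have nv : nbC c1 c2 c3 c4 c5 v.
    by rewrite /nbC; case/orP: h => ->; rewrite ?orbT.
  have wv : w -- v by rewrite adjC.
  have /andP[vC _] := ev_near hS hw wv nv; split=> //.
  have wO : w \in Om by case/and3P: hw.
  have := clO _ _ wO wv; case/orP: h => h.
    by rewrite !(one_nbr hG hC vC h) !orbF.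
  by rewrite !(one_nbr2 hG hC vC h) !orbF.
have [n1C n1O] : n1 \notin [:: c1; c2; c3; c4; c5] /\ n1 \in Om.
  by apply: attC hw1 nw1 _; rewrite nc1.
have [n2C n2O] : n2 \notin [:: c1; c2; c3; c4; c5] /\ n2 \in Om.
  by apply: attC hw2 nw2 _; rewrite nc2 orbT.
have e : m' = m := jumps_share hG hC n1C n2C mC' mC nc1 nc2 mc' mc nm1 nm2.
subst m'; move: mC' mc' => _ _.
have E1 := one_nbr hG hC n1C nc1; have E2 := one_nbr2 hG hC n2C nc2.
have Em := one_nbr4 hG hC mC mc.
have /andP[ne12 na12] := class12_nadj hG hC n1C n2C nc1 nc2.
(* The descent continues from this 5-cycle: the region [X] below can be left only
   through its vertices. *)
have hK : hole5 n2 c2 c1 n1 m.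
  rewrite /hole5 /= !inE !(E, E1, E2, Em) [m -- n2]adjC nm1 nm2.
  by rewrite eq_sym (negbTE ne12) (negbTE (adj_neq nm2)) (negbTE (adj_neq nm1)).
pose X := [set v | [&& v != n1, v != n2 & edge_vertex c1 c2 c3 c4 c5 Om v ||
   [exists w, [&& edge_vertex c1 c2 c3 c4 c5 Om w, v -- w & nbC c1 c2 c3 c4 c5 v]]]].
have XO : {subset X <= Om}.
  move=> v; rewrite inE => /and3P[_ _ /orP[/and3P[]//|/existsP[w /and3P[hw vw nv]]]].
  have wv : w -- v by rewrite adjC.
  have /andP[vC h] := ev_near hS hw wv nv.
  by have [] := attC v w hw vw h.
(* Leaving out [n1] is what makes the region smaller than [Om]. *)
have Xn : #|X| <= n.
  rewrite -ltnS; apply: leq_trans On; apply: proper_card; apply/properP.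
  split; first by apply/subsetP.
  by exists n1; rewrite // inE eqxx.
have clX v y : v \in X -> v -- y ->
    (y \in X) || (y \in [:: n1; n2; c1; c2]).
  rewrite inE => /and3P[v1 v2 hv] vy.
  case: (eqVneq y n1) => [->|y1]; first by rewrite mem_head orbT.
  case: (eqVneq y n2) => [->|y2]; first by rewrite !inE eqxx !orbT.
  have inX : edge_vertex c1 c2 c3 c4 c5 Om y -> (y \in X) || (y \in [:: n1; n2; c1; c2]).
    by move=> h; rewrite inE y1 y2 h.
  case/orP: hv => [hv|/existsP[w /and3P[hw vw nv]]].
    case: (boolP (nbC c1 c2 c3 c4 c5 y)) => ny; last first.
      by apply: inX; apply: (ev_adj hS) vy ny.
    rewrite inE y1 y2 /=; apply/orP; left; apply/orP; right.
    by apply/existsP; exists v; rewrite hv ny adjC vy.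
  have wv : w -- v by rewrite adjC.
  have /andP[vC] := ev_near hS hw wv nv; case/orP => vc.
    have hw' := hw; rewrite -edge_vertex_flip in hw'.
    have := ev_class2_nbr hA hJ hS' hw' vw vc vy.
    rewrite edge_vertex_flip flipC => /or3P[/eqP->|/inX//|/andP[yC yc]].
      by rewrite !inE eqxx !orbT.
    (* Every jump lands on [m]; so [v] and [n1] share the neighbours [c1] and [m] and coincide. *)
    have ey := jumps_share hG hC vC n2C yC mC vc nc2 yc mc vy nm2.
    case/eqP: v1; apply: (@common_nbr _ hG c1 m).
    - by rewrite eq_sym; rewrite Em.
    - by rewrite adjC.
    - by rewrite -ey adjC.
    - by rewrite E1.
    - by rewrite adjC.
  have := ev_class2_nbr hA hJ hS hw vw vc vy.
  case/or3P => [/eqP->|/inX//|/andP[yC yc]].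
    by rewrite !inE eqxx !orbT.
  have ey := jumps_share hG hC n1C vC mC yC nc1 vc mc yc nm1 vy.
  case/eqP: v2; apply: (@common_nbr _ hG c2 m).
  - by rewrite eq_sym; rewrite Em.
  - by rewrite adjC.
  - by rewrite ey adjC.
  - by rewrite E2.
  - by rewrite adjC.
have hK' : hole5 n1 c1 c2 n2 m := hole5_rot (hole5_rev hK).
have EK := hole5E hG hK.
have far_near v y : edge_vertex c1 c2 c3 c4 c5 Om v -> nbC c1 c2 c3 c4 c5 y -> (v == y) = false.
  by case/and3P=> _ nv _ ny; apply/eqP=> e; rewrite e ny in nv.
have n1near : nbC c1 c2 c3 c4 c5 n1 by rewrite /nbC nc1.
have n2near : nbC c1 c2 c3 c4 c5 n2 by rewrite /nbC nc2 orbT.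
have mnear : nbC c1 c2 c3 c4 c5 m by rewrite /nbC mc !orbT.
have c1near : nbC c1 c2 c3 c4 c5 c1 by rewrite (nbC_hole hG) // mem_head.
have c2near : nbC c1 c2 c3 c4 c5 c2 by rewrite (nbC_hole hG) // !inE eqxx orbT.
have evX v : edge_vertex c1 c2 c3 c4 c5 Om v -> v \in X.
  by move=> h; rewrite inE h !far_near.
have evK v : edge_vertex c1 c2 c3 c4 c5 Om v -> v \notin [:: n2; c2; c1; n1; m].
  by move=> h; rewrite !inE !far_near.
have evK' v : edge_vertex c1 c2 c3 c4 c5 Om v -> v \notin [:: n1; c1; c2; n2; m].
  by move=> h; rewrite !inE !far_near.
(* A neighbour of [f] far from the new hole would start a descent inside [X]. *)
have noK f w : edge_vertex c1 c2 c3 c4 c5 Om f -> f -- n2 -> f -- w -> nbC n2 c2 c1 n1 m w.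
  move=> hf fn fw; apply: contraT => nw.
  have wX : w \in X.
    case/orP: (clX _ _ (evX _ hf) fw) => // h; case/negP: nw.
    by apply: (nbC_hole hG hK); move: h; rewrite !inE => /or4P[] ->; rewrite ?orbT.
  case: ng; have [|v y vX vy|x [W [hW WX _]]] := descend hG hP3 hP9 hA hJ hK fn fw nw wX Xn.
  - by left.
  - case/orP: (clX _ _ vX vy) => [->//|].
    by rewrite !inE => /or4P[] /eqP->; rewrite !EK ?orbT.
  by exists x, W; split=> // t /WX/XO.
have noK' f w : edge_vertex c1 c2 c3 c4 c5 Om f -> f -- n1 -> f -- w -> nbC n1 c1 c2 n2 m w.
  move=> hf fn fw; apply: contraT => nw.
  have wX : w \in X.
    case/orP: (clX _ _ (evX _ hf) fw) => // h; case/negP: nw.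
    by apply: (nbC_hole hG hK'); move: h; rewrite !inE => /or4P[] ->; rewrite ?orbT.
  case: ng; have [|v y vX vy|x [W [hW WX _]]] := descend hG hP3 hP9 hA hJ hK' fn fw nw wX Xn.
  - by left.
  - case/orP: (clX _ _ vX vy) => [->//|].
    by rewrite !inE => /or4P[] /eqP->; rewrite !EK ?orbT.
  by exists x, W; split=> // t /WX/XO.
have w2n : w2 -- n2 by rewrite adjC.
have [[u w2u uc] [p w2p pn]] := near_nbrs hG hK (hdeg w2) (evK _ hw2) w2n
  (fun w => noK _ _ hw2 w2n).
have hp : edge_vertex c1 c2 c3 c4 c5 Om p.
  apply: (ev_adj hS hw2 w2p); apply/negP=> np.
  case/andP: (ev_near hS hw2 w2p np) => pC /orP[pc|pc].
    by apply: (@no_triangle _ hG p n1 c1); rewrite // adjC.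
  by have := class12_nadj hG hC n1C pC nc1 pc; rewrite [n1 -- p]adjC pn andbF.
have [[t pt tc] _] := near_nbrs hG hK' (hdeg p) (evK' _ hp) pn
  (fun w => noK' _ _ hp pn).
have Ew := one_nbr hG hK (evK _ hw2) w2n.
have Ep := one_nbr hG hK' (evK' _ hp) pn.
(* The hole is read as [c1 n1 m n2 c2]; the vertices [u], [p], [w2], [t] hang on [c1], [n1], [n2],
   [c2], and the deleted vertex would hang on [m]. *)
apply: hP9; exists c1, n1, m, n2, c2, u, p, w2, t.
have hK2 := hole5_rot (hole5_rot hK); split=> //.
  split.
  - rewrite !inE !negb_or; apply/and5P; split; apply/eqP=> e; move: w2u uc; rewrite e ?Ew //.
    by rewrite E2.
  - by have := evK _ hp; rewrite !inE !negb_or => /and5P[-> -> -> -> ->].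
  - by have := evK _ hw2; rewrite !inE !negb_or => /and5P[-> -> -> -> ->].
  - rewrite !inE !negb_or; apply/and5P; split; apply/eqP=> e; move: pt tc; rewrite e ?Ep //.
    by rewrite E1.
by split; rewrite // adjC.
Qed.

Lemma descents n : edge_descent G n /\ P3_descent G n.
Proof.
elim: n => [|n [hA hJ]].
  split=> [c1 c2 c3 c4 c5 D Om _ hD _ DO|c1 c2 c3 c4 c5 D _ hD _].
    by rewrite leqn0 cards_eq0 => /eqP e; have [w /DO] := far_n0 hD; rewrite e inE.
  by rewrite leqn0 cards_eq0 => /eqP e; have [w] := far_n0 hD; rewrite e inE.
have hA' := edge_descentS hA hJ.
by split=> //; apply: P3_descentS.
Qed.

End Descent.

(** * Bipartite graphs *)

Lemma not_uniq_split (T : eqType) (p : seq T) : ~~ uniq p ->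
  exists (a : seq T) u b c, p = a ++ u :: b ++ u :: c.
Proof.
elim: p => [|x p IH] //=; rewrite negb_and negbK => /orP[|/IH].
  by case/splitPr=> b c; exists [::], x, b, c.
by case=> a [u [b [c ->]]]; exists (x :: a), u, b, c.
Qed.

Section Bipartite.

Variable G : sgraph.
Implicit Types (a b c d x y z u v w : G).
Implicit Types (p q r s : seq G) (X Y D W Om : {set G}).

Section MinimalOddCycle.

Variable p : seq G.
Hypothesis cp : cycle (@adj G) p.
Hypothesis op : odd (size p).
Hypothesis mp : forall q, cycle (@adj G) q -> odd (size q) -> size p <= size q.

(** A repeated vertex splits the closed walk into two shorter ones, of which one is odd. *)
Lemma minimal_odd_uniq : uniq p.
Proof.
apply: contraT => /not_uniq_split [a [u [b [c e]]]].
have h : cycle (@adj G) (u :: b ++ u :: c ++ a).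
  by move: cp; rewrite e -(rot_cycle (size a)) rot_size_cat /= -catA.
have s : size p = (size b).+1 + (size (c ++ a)).+1.
  by rewrite e !size_cat /= !size_cat /= !addnS !addSn [size a + _]addnC addnA.
move: h; rewrite /= rcons_cat rcons_cons cat_path /= => /and3P[h1 h2 h3].
case ob: (odd (size b).+1).
  have := mp (q := u :: b) _ ob; rewrite /= rcons_path h1 h2 => /(_ isT).
  by rewrite s -[X in _ <= X]addn0 leq_add2l.
have oc : odd (size (c ++ a)).+1 by move: op; rewrite s oddD ob.
have := mp (q := u :: c ++ a) h3 oc.
by rewrite s -[X in _ <= X]add0n leq_add2r.
Qed.

(** A chord splits the cycle into two whose lengths add up to [size p + 2]. One of them is odd, and
    it is shorter than [p] as both arcs have interior vertices. *)
Lemma minimal_odd_induced : induced_cycle p.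
Proof.
have up := minimal_odd_uniq; split.
  rewrite /is_cycle up cp !andbT; case: p cp op => [|x [|y [|]]] //=.
  by rewrite adj_irr.
move=> u v hu hv uv.
have [i q e] := rot_to hu.
have hq : v \in q.
  have : v \in u :: q by rewrite -e mem_rot.
  by rewrite inE => /orP[/eqP h|//]; rewrite h adj_irr in uv.
case/splitPr: hq e => b c e.
have uq : uniq (u :: b ++ v :: c) by rewrite -e rot_uniq.
rewrite -(next_rot i up) -(next_rot i up v) e.
have h : cycle (@adj G) (u :: b ++ v :: c) by rewrite -e rot_cycle.
have s : size p = (size b + size c).+2.
  by rewrite -(size_rot i) e /= size_cat /= addnS.
move: h; rewrite /= rcons_cat rcons_cons cat_path => /andP[h1 /andP[h2 h3]].
have vu : v -- u by rewrite adj_sym.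
case: b uq e s h1 h2 => [|b0 b] uq e s h1 h2; first by left; rewrite /= eqxx.
case/lastP: c uq e s h3 => [|c c0] uq e s h3.
  right; have -> : (b0 :: b) ++ [:: v] = rcons (b0 :: b) v by rewrite cats1.
  by rewrite -/(next (u :: rcons (b0 :: b) v) v) next_last // -cats1.
exfalso; case ob: (odd (size (b0 :: b))).
  have := mp (q := u :: rcons (b0 :: b) v) _ _; rewrite [size (_ :: _)]/= size_rcons.
  rewrite [odd _]/= negbK => /(_ _ ob).
  rewrite /cycle rcons_path last_rcons vu andbT rcons_path h1 h2 => /(_ isT).
  by rewrite s !ltnS size_rcons -[X in _ <= X]addn0 leq_add2l.
have hc : cycle (@adj G) (u :: v :: rcons c c0) by rewrite /= uv.
have oc : odd (size (u :: v :: rcons c c0)).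
  move: op ob; rewrite s [size (u :: _)]/=.
  move: (size (b0 :: b)) (size (rcons c c0)) => k l.
  by rewrite /= !negbK oddD => h kl; rewrite kl in h.
have := mp hc oc.
by rewrite s /= !ltnS -[X in _ <= X]add0n leq_add2r.
Qed.

End MinimalOddCycle.

(* A proper 2-colouring is read off the bipartite double cover, where a vertex
   whose two lifts are connected gives an odd closed walk. *)
Lemma bipartite_or_odd_cycle :
  bipartite G \/ exists2 p, cycle (@adj G) p & odd (size p).
Proof.
pose e := [rel s t : G * bool | adj s.1 t.1 && (s.2 != t.2)].
have es : connect_sym e.
  by apply: sym_connect_sym => s t; rewrite /e /= adj_sym eq_sym.
case: (boolP [exists u, connect e (u, true) (u, false)]).
  case/existsP=> u /connectP [p hp hl]; right.
  have h1 (x : G * bool) (q : seq (G * bool)) : path e x q -> path (@adj G) x.1 (map fst q).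
    by elim: q x => [|y q IH] x //= /andP[/andP[-> _] /IH].
  have h2 (x : G * bool) (q : seq (G * bool)) : path e x q -> (last x q).2 = x.2 (+) odd (size q).
    elim: q x => [|y q IH] x /=; first by rewrite addbF.
    case/andP=> /andP[_ xy] /IH ->; move: xy.
    by case: (x.2) (y.2) (odd _) => [] [] [].
  have op : odd (size p) by have := h2 _ _ hp; rewrite -hl /=; case: (odd _).
  have := h1 _ _ hp; have hm : last u (map fst p) = u by rewrite (last_map fst p (u, true)) -hl.
  case/lastP: p hp hl op hm => // p t hp hl op.
  rewrite map_rcons last_rcons => <- h.
  by exists (t.1 :: map fst p); rewrite // /= size_map; move: op; rewrite size_rcons.
rewrite negb_exists => /forallP hn; left.
pose r u := root (@adj G) u.
have as_ : connect_sym (@adj G) by apply: sym_connect_sym => u v; rewrite adj_sym.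
exists (fun u => connect e (r u, true) (u, true)) => u v uv.
have -> : r v = r u.
  by apply/esym/eqP; rewrite (root_connect as_); apply: connect1.
have walk x w : connect (@adj G) x w -> exists b : bool, connect e (x, true) (w, b).
  case/connectP=> p; elim/last_ind: p w => [|p t IH] w.
    by move=> _ ->; exists true.
  rewrite rcons_path last_rcons => /andP[hp ht] ->.
  case: (IH _ hp erefl) => b hb; exists (~~ b).
  by apply: connect_trans hb (connect1 _); rewrite /e /= ht; case: b.
have lift : exists b : bool, connect e (r u, true) (u, b).
  by apply: walk; rewrite as_ connect_root.
have step (b : bool) : connect e (r u, true) (u, b) -> connect e (r u, true) (v, ~~ b).
  by move=> h; apply: connect_trans h (connect1 _); rewrite /e /= uv; case: b.
have no w (b : bool) : connect e (r u, true) (w, b) -> ~~ connect e (r u, true) (w, ~~ b).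
  move=> h; apply/negP=> h'; move: (hn w); rewrite es in h.
  case: b h h' => h h'; first by rewrite (connect_trans h h').
  by rewrite es (connect_trans h h').
case: lift => b hb; case: b hb => hb.
  by rewrite hb (negbTE (no _ _ (step _ hb))).
by rewrite (negbTE (no _ _ hb)) (step _ hb).
Qed.

Hypothesis hG : pentagraph G.

Lemma bipartite_or_hole5 :
  bipartite G \/ exists c1 c2 c3 c4 c5 : G, hole5 c1 c2 c3 c4 c5.
Proof.
case: bipartite_or_odd_cycle => [|[p cp op]]; [by left | right].
have: exists q, [/\ cycle (@adj G) q, odd (size q) &
    forall r, cycle (@adj G) r -> odd (size r) -> size q <= size r].
  move: {2}(size p) (leqnn (size p)) => n; elim: n p cp op => [|n IH] p cp op hn.
    by exists p; split=> // r _ _; apply: leq_trans hn _.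
  case: (classic (exists r, [/\ cycle (@adj G) r, odd (size r) & size r <= n])).
    by case=> r [cr or rn]; apply: IH cr or rn.
  move=> no; exists p; split=> // r cr or; rewrite leqNgt; apply/negP=> h.
  by apply: no; exists r; split=> //; rewrite -ltnS; apply: leq_trans hn.
case=> q [cq oq mq]; have hq := minimal_odd_induced cq oq mq.
have s5 := hG.2 _ hq oq.
have uq := minimal_odd_uniq cq oq mq.
case: q s5 cq uq {oq mq hq} => [|c1 [|c2 [|c3 [|c4 [|c5 []]]]]] // _ h uq.
exists c1, c2, c3, c4, c5; rewrite /hole5 uq.
by move: h; rewrite /= => /and5P[-> -> -> -> /andP[-> _]].
Qed.

(** * No good pair, hence no 5-hole *)

Hypothesis hP3 : ~ exists p : seq G, P3_cutset p.
Hypothesis hP9 : ~ petersen_minus_vertex G.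
Hypothesis hdeg : forall v, 2 < degree v.
Hypothesis hS : ~ exists X : {set G}, strong_parity_star_cutset X.

(** Otherwise [near_nbrs] gives both [x] and [y] a neighbour in the class of [c1]; these agree by
    [jumps_share]. With the neighbour of [y] in the class of [c2] they form the Petersen graph minus
    a vertex. *)
Lemma near_pair c1 c2 c3 c4 c5 x y : hole5 c1 c2 c3 c4 c5 ->
  x \notin [:: c1; c2; c3; c4; c5] -> y \notin [:: c1; c2; c3; c4; c5] ->
  x -- c3 -> y -- c4 ->
  (exists w, (x -- w) && ~~ nbC c1 c2 c3 c4 c5 w) \/
  (exists w, (y -- w) && ~~ nbC c1 c2 c3 c4 c5 w).
Proof.
move=> hC xC yC xc yc.
case: (boolP [exists w, (x -- w) && ~~ nbC c1 c2 c3 c4 c5 w]) => [/existsP|].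
  by left.
case: (boolP [exists w, (y -- w) && ~~ nbC c1 c2 c3 c4 c5 w]) => [/existsP|].
  by right.
rewrite !negb_exists => /forallP hy /forallP hx; exfalso; apply: hP9.
have hC3 := hole5_rot (hole5_rot hC); have xC3 := notin_rot (notin_rot xC).
have yC3 := notin_rot (notin_rot yC).
have hC4 := hole5_rot hC3; have yC4 := notin_rot yC3.
have [|_ [u xu uc]] := near_nbrs hG hC3 (hdeg x) xC3 xc.
  by move=> w xw; rewrite 2!nbC_rot; have := hx w; rewrite xw /= negbK.
have [|[v yv vc] [t yt tc]] := near_nbrs hG hC4 (hdeg y) yC4 yc.
  by move=> w yw; rewrite 3!nbC_rot; have := hy w; rewrite yw /= negbK.
have Ex := one_nbr hG hC3 xC3 xc; have Ey := one_nbr hG hC4 yC4 yc.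
have E := hole5E hG hC.
have uC : u \notin [:: c3; c4; c5; c1; c2].
  by rewrite !inE !negb_or; apply/and5P; split; apply/eqP=> e;
    move: uc xu; rewrite e ?E ?Ex.
have vC : v \notin [:: c3; c4; c5; c1; c2].
  by rewrite !inE !negb_or; apply/and5P; split; apply/eqP=> e;
    move: vc yv; rewrite e ?E ?Ey.
have tC : t \notin [:: c3; c4; c5; c1; c2].
  by rewrite !inE !negb_or; apply/and5P; split; apply/eqP=> e;
    move: tc yt; rewrite e ?E ?Ey.
have e := jumps_share hG hC3 xC3 yC3 uC vC xc yc uc vc xu yv; subst v.
exists c3, c4, c5, c1, c2, x, y, u, t; split=> //.
by split; rewrite // adjC.
Qed.

Lemma third_nbr c1 c2 c3 c4 c5 : hole5 c1 c2 c3 c4 c5 ->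
  exists2 x, x \notin [:: c1; c2; c3; c4; c5] & x -- c1.
Proof.
move=> hC; have E := hole5E hG hC.
have [u [w [cu cw uw uc wc]]] := degree_gt2 c2 (hdeg c1).
have key t : c1 -- t -> t != c2 -> t != c5 -> t \notin [:: c1; c2; c3; c4; c5].
  move=> ct t2 t5; rewrite !inE (negbTE t2) (negbTE t5) !orbF /=.
  by rewrite !negb_or; apply/and3P; split; apply/eqP=> e; move: ct; rewrite e ?E // adj_irr.
case: (eqVneq u c5) => [u5|u5]; last by exists u; [apply: key | rewrite adjC].
by exists w; [apply: key; rewrite // -u5 eq_sym | rewrite adjC].
Qed.

(** Third neighbours of [p] and [q] lie in [W], and one of them has a neighbour far from
    [x a p q b]. The region [W] is left only through neighbours of [x], so a descent runs inside it.
    The new component avoids the neighbours of [b] (or of [a]), hence misses [q] (or [p]) and is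
    smaller. *)
Lemma no_good k x W : good x W -> #|W| <= k -> False.
Proof.
elim: k x W => [|k IH] x W hW Wk.
  by have [w] := good_n0 hW; move: Wk; rewrite leqn0 cards_eq0 => /eqP->; rewrite inE.
have [hA hJ] := descents hG hP3 hP9 hdeg #|W|.
case: (good_hole5 hG hW) => [//|[a [p [q [b [pW qW hC]]]]]].
have E := hole5E hG hC.
have hC3 := hole5_rot (hole5_rot hC); have hC4 := hole5_rot hC3.
have [n3 n3C n3p] := third_nbr hC3; have [n4 n4C n4q] := third_nbr hC4.
have E3 := one_nbr hG hC3 n3C n3p; have E4 := one_nbr hG hC4 n4C n4q.
have n3W : n3 \in W.
  by have := good_closed hW pW; move=> /(_ n3); rewrite [p -- n3]adjC n3p E3 orbF; apply.
have n4W : n4 \in W.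
  by have := good_closed hW qW; move=> /(_ n4); rewrite [q -- n4]adjC n4q E4 orbF; apply.
have inW f w : f \in W -> f -- w -> ~~ nbC x a p q b w -> w \in W.
  move=> fW fw nw; case/orP: (good_closed hW fW fw) => // h; case/negP: nw.
  by rewrite /nbC adjC h.
have small x' W' : good x' W' -> {subset W' <= W} -> (exists2 t, t \in W & t \notin W') -> False.
  move=> h WW [t tW tW']; apply: (IH x' W' h); rewrite -ltnS; apply: leq_trans Wk.
  by apply: proper_card; apply/properP; split; [apply/subsetP | exists t].
have n3C' := notin_rot (notin_rot (notin_rot n3C)).
have n4C' := notin_rot (notin_rot n4C).
case: (near_pair hC n3C' n4C' n3p n4q) => -[w /andP[fw nw]].
  have wW := inW _ _ n3W fw nw.
  have nw3 : ~~ nbC p q b x a w by rewrite 2!nbC_rot.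
  have [|v y vW vy|x' [W' [h WW ad]]] := descend hG hP3 hP9 hA hJ hC3 n3p fw nw3 wW (leqnn _).
  - by left.
  - by case/orP: (good_closed hW vW vy) => [->//|h]; rewrite [y -- x]adjC h !orbT.
  apply: (small x' W' h WW); exists q => //; apply/negP=> /ad.
  by rewrite E.
have wW := inW _ _ n4W fw nw.
have nw4 : ~~ nbC q b x a p w by rewrite 3!nbC_rot.
have [|v y vW vy|x' [W' [h WW ad]]] := descend hG hP3 hP9 hA hJ hC4 n4q fw nw4 wW (leqnn _).
- by left.
- by case/orP: (good_closed hW vW vy) => [->//|h]; rewrite [y -- x]adjC h !orbT.
apply: (small x' W' h WW); exists p => //; apply/negP=> /ad.
by rewrite !E andbF.
Qed.

Lemma bipartite_of_no_cutset : bipartite G.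
Proof.
case: bipartite_or_hole5 => // -[c1 [c2 [c3 [c4 [c5 hC]]]]]; exfalso.
have hC3 := hole5_rot (hole5_rot hC); have hC4 := hole5_rot hC3.
have [n3 n3C n3c] := third_nbr hC3; have [n4 n4C n4c] := third_nbr hC4.
have n3C' := notin_rot (notin_rot (notin_rot n3C)).
have n4C' := notin_rot (notin_rot n4C).
have [hA hJ] := descents hG hP3 hP9 hdeg #|[set: G]|.
case: (near_pair hC n3C' n4C' n3c n4c) => -[w /andP[fw nw]].
  have nw3 : ~~ nbC c3 c4 c5 c1 c2 w by rewrite 2!nbC_rot.
  have [|v y _ _|x' [W' [h _ _]]] :=
    descend hG hP3 hP9 hA hJ hC3 n3c fw nw3 (in_setT w) (leqnn _).
  - by left.
  - by rewrite inE.
  exact: no_good h (leqnn _).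
have nw4 : ~~ nbC c4 c5 c1 c2 c3 w by rewrite 3!nbC_rot.
have [|v y _ _|x' [W' [h _ _]]] :=
  descend hG hP3 hP9 hA hJ hC4 n4c fw nw4 (in_setT w) (leqnn _).
- by left.
- by rewrite inE.
exact: no_good h (leqnn _).
Qed.

End Bipartite.

(** * The Petersen graph *)

(* The Petersen graph on 0..9, vertex [i] being the [i]-th of these 2-subsets of
   {0..4}: the 5-cycle c1..c5, then n1, n2, n4, n5 and the remaining vertex n3. *)
Definition kneser_pairs : seq (nat * nat) :=
  [:: (0,1); (2,3); (0,4); (1,2); (3,4); (2,4); (1,4); (0,3); (0,2); (1,3)].

(** The default [(0, 1)] is itself a valid pair, so [kpair_lt] and [pair_of] need no bound on
    [i]. *)
Definition kpair i := nth (0, 1) kneser_pairs i.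

Definition kneser i j :=
  [&& (kpair i).1 != (kpair j).1, (kpair i).1 != (kpair j).2,
      (kpair i).2 != (kpair j).1 & (kpair i).2 != (kpair j).2].

(* The edge between 9 and [m] is removed; [m = 10] removes nothing. *)
Definition kneser_del m i j :=
  kneser i j && ~~ ((i == 9) && (j == m) || (j == 9) && (i == m)).

Fixpoint index_chordless (e : rel nat) (p : seq nat) : bool :=
  if p is x :: p' then
    (if p' is y :: s then
       [&& e x y, x \notin p', all (fun z => ~~ e x z) s & index_chordless e p']
     else true)
  else true.

Definition far_pairs n (e : rel nat) (P : nat -> nat -> bool) :=
  all (fun i => all (fun j => if (i == j) || e i j then true else P i j)
    (iota 0 n)) (iota 0 n).

(* [if] rather than [&&]: under [vm_compute] the latter evaluates both sides. *)
Definition has_path3 n e i j :=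
  has (fun a => if e i a then has (fun b =>
    index_chordless e [:: i; a; b; j]) (iota 0 n) else false) (iota 0 n).

Definition has_path4 n e i j :=
  has (fun a => if e i a then has (fun b => if e a b then has (fun c =>
    index_chordless e [:: i; a; b; c; j])
      (iota 0 n) else false) (iota 0 n) else false) (iota 0 n).

Definition has_path5 n e i j :=
  has (fun a => if e i a then has (fun b => if e a b then has (fun c =>
    if e b c then has (fun d => index_chordless e [:: i; a; b; c; d; j])
      (iota 0 n) else false) (iota 0 n) else false) (iota 0 n) else false) (iota 0 n).

Definition common n (e : rel nat) i j := has (fun k => e i k && e k j) (iota 0 n).

(** The first two conjuncts give induced paths of both parities, as [linked_pair] requires. The
    third forbids an outside vertex adjacent to both [i] and [j]: it would lie on a 4-cycle or a
    7-hole. *)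
Lemma kneser_paths m : m \in [:: 2; 5; 8; 10] ->
  far_pairs 10 (kneser_del m) (fun i j =>
    [&& if has_path3 10 (kneser_del m) i j then true else has_path5 10 (kneser_del m) i j,
        has_path4 10 (kneser_del m) i j &
        if common 10 (kneser_del m) i j then true else has_path5 10 (kneser_del m) i j]).
Proof. by rewrite !inE => /or4P[] /eqP->; vm_compute. Qed.

(** The vertices 2, 5, 8 are the neighbours of the missing vertex 9, so they are the only
    nonadjacent pairs that have lost their common neighbour. *)
Lemma kneser9_paths :
  far_pairs 9 kneser (fun i j =>
    [&& if has_path3 9 kneser i j then true else has_path5 9 kneser i j, has_path4 9 kneser i j &
        common 9 kneser i j || (i \in [:: 2; 5; 8]) && (j \in [:: 2; 5; 8])]).
Proof. by vm_compute. Qed.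

(** Lets every edge grow to an induced three-vertex path with some vertex left over, which is then
    separated from the component cut off. *)
Definition has_ext n (e : rel nat) :=
  all (fun i => has (e i) (iota 0 n) && all (fun j => ~~ e i j ||
    has (fun k => index_chordless e [:: i; j; k] &&
      has (fun l => l \notin [:: i; j; k]) (iota 0 n)) (iota 0 n)) (iota 0 n)) (iota 0 n).

Lemma kneser_ext m : m \in [:: 2; 5; 8; 10] -> has_ext 10 (kneser_del m).
Proof. by rewrite !inE => /or4P[] /eqP->; vm_compute. Qed.

Lemma kneser9_ext : has_ext 9 kneser.
Proof. by vm_compute. Qed.

(** * Copies of small graphs and what attaches to them *)

Section Embed.

Variable G : sgraph.
Implicit Types (u v w x y z : G) (D : {set G}) (i j k l n : nat).

Hypothesis hG : pentagraph G.

Record embeds n (e : rel nat) (s : seq G) : Prop := Embeds {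
  emb_size : size s = n;
  emb_uniq : uniq s;
  emb_adj : forall x i j, i < n -> j < n -> nth x s i -- nth x s j = e i j }.

Section Fix.

Variables (n : nat) (e : rel nat) (s : seq G) (x0 : G).
Hypothesis hs : embeds n e s.
Notation h := (nth x0 s).

Lemma emb_eq i j : i < n -> j < n -> (h i == h j) = (i == j).
Proof. by move=> hi hj; rewrite nth_uniq ?(emb_uniq hs) // (emb_size hs). Qed.

Lemma emb_in i : i < n -> h i \in s.
Proof. by move=> hi; rewrite mem_nth // (emb_size hs). Qed.

Lemma emb_onto v : v \in s -> exists2 i, i < n & v = h i.
Proof.
by move=> vs; exists (index v s); rewrite ?nth_index // -(emb_size hs) index_mem.
Qed.

Lemma emb_sym i j : i < n -> j < n -> e i j = e j i.
Proof. by move=> hi hj; rewrite -!(emb_adj hs x0) // adjC. Qed.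

Lemma emb_chordless p : all (fun i => i < n) p -> index_chordless e p ->
  chordless (map h p).
Proof.
elim: p => [|i [|j p] IH] //.
move=> /andP[hi hp]; have -> : index_chordless e [:: i, j & p] =
  [&& e i j, i \notin j :: p, all (fun k => ~~ e i k) p & index_chordless e (j :: p)] by [].
case/and4P=> eij inp /allP ip hc; have hall : all (fun i => i < n) (j :: p) := hp.
have [hj hp'] : j < n /\ all (fun i => i < n) p by case/andP: hp.
rewrite -[map _ (i :: _)]/(h i :: h j :: map h p) chordless_cons; apply/and4P; split.
- by rewrite (emb_adj hs).
- apply: contra inp; rewrite -[h j :: _]/(map h (j :: p)) => /mapP[k kp /eqP].
  have hk : k < n by move/allP: hall => /(_ k kp).
  by rewrite emb_eq // => /eqP->.
- rewrite all_map; apply/allP=> k kp /=.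
  have hk : k < n by move/allP: hp' => /(_ k kp).
  by rewrite (emb_adj hs) //; apply: ip.
- exact: IH hp hc.
Qed.

Lemma far_pairsP P i j : far_pairs n e P -> i < n -> j < n -> i != j -> ~~ e i j -> P i j.
Proof.
rewrite /far_pairs => /allP hP hi hj ij eij; have := hP i; rewrite mem_iota => /(_ hi).
by move/allP=> /(_ j); rewrite mem_iota (negbTE ij) (negbTE eij); apply.
Qed.

Lemma has_iota (P : pred nat) : has P (iota 0 n) -> exists2 k, k < n & P k.
Proof. by case/hasP=> k; rewrite mem_iota => hk Pk; exists k. Qed.

Lemma has_pathP i j (r : seq nat) : i < n -> j < n -> all (fun k => k < n) r ->
  index_chordless e (i :: rcons r j) -> chordless (h i :: rcons (map h r) (h j)).
Proof.
move=> hi hj hr hc; have := emb_chordless _ hc.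
by rewrite /= map_rcons; apply; rewrite hi all_rcons hj.
Qed.

(* A shortest path through [D] joining two nonadjacent vertices of the embedded
   graph meets only these and their common neighbours, so if it has an interior of
   at least two vertices it closes up to an odd hole with one of the two paths
   inside the embedded graph. *)
Lemma linked_pair D :
  far_pairs n e (fun i j => (has_path3 n e i j || has_path5 n e i j) && has_path4 n e i j) ->
  {in D, forall w, w \notin s} ->
  forall i j q, i < n -> j < n -> i != j -> ~~ e i j ->
    {subset q <= D} -> path (@adj G) (h i) (rcons q (h j)) ->
  exists k l y, [/\ y \in D, k < n /\ l < n, k != l, ~~ e k l & y -- h k /\ y -- h l].
Proof.
move=> hP Ds i j q; move: {2}(size q) (leqnn (size q)) => N.
elim: N i j q => [|N IH] i j q hN hi hj ij eij qD hq.
  move: hN hq; rewrite leqn0 size_eq0 => /eqP-> /=.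
  by rewrite (emb_adj hs) // (negbTE eij).
case: (classic (exists k l r, [/\ size r <= N, k < n, l < n, k != l & [/\ ~~ e k l,
    {subset r <= D} & path (@adj G) (h k) (rcons r (h l))]])).
  by case=> k [l [r [hr hk hl kl [ekl rD pr]]]]; apply: IH hr hk hl kl ekl rD pr.
move=> min.
have mn k l (r : seq G) : k < n -> l < n -> k != l -> ~~ e k l -> {subset r <= D} ->
    path (@adj G) (h k) (rcons r (h l)) -> N < size r.
  move=> hk hl kl ekl rD pr; rewrite ltnNge; apply/negP=> hr.
  by apply: min; exists k, l, r.
have nij : h i != h j by rewrite emb_eq.
have [q' [hc q'D sq']] : exists q', [/\ chordless (h i :: rcons q' (h j)),
    {subset q' <= D} & size q' <= size q].
  have [p' hp' []] := path_chordless hq; rewrite last_rcons.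
  case/lastP: p' hp' => [|q' t] hp' /=; first by move=> ee; rewrite ee eqxx in nij.
  rewrite last_rcons => ee sub; subst t; exists q'.
  have u' : uniq (rcons q' (h j)) := chordless_uniq (chordless_behead hp').
  have q'q : {subset q' <= q}.
    move=> t tq; have := sub t; rewrite !mem_rcons !inE tq orbT => /(_ isT).
    case/orP=> // /eqP ee; move: u'; rewrite rcons_uniq => /andP[].
    by rewrite -ee tq.
  split=> // [t /q'q/qD //|]; apply: uniq_leq_size q'q.
  by move: u'; rewrite rcons_uniq => /andP[].
have {sq'} sq : size q' = N.+1.
  apply/eqP; rewrite eqn_leq (leq_trans sq' hN) /=.
  by apply: mn hi hj ij eij q'D _; apply: chordless_path.
have pq := chordless_path hc.
case: N hN IH min mn sq => [|N] _ _ _ mn sq.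
  case: q' sq hc q'D pq => [|y []] // _ _ q'D /= /and3P[iy yj _].
  exists i, j, y; split=> //; first by apply: q'D; rewrite mem_head.
  by rewrite adjC.
exfalso; have q0 : q' != [::] by rewrite -size_eq0 sq.
(* If [k] is nonadjacent to [i], minimality allows [t] only at the end next to [j], and
   symmetrically. Adjacency to exactly one of [i], [j] then closes a triangle; adjacency to neither
   leaves a single interior vertex. *)
have off (k : nat) (t : G) : k < n -> k != i -> k != j -> ~~ (e k i && e k j) ->
    t \in q' -> ~~ t -- h k.
  move=> hk ki kj nk tq; apply/negP=> tk.
  case/splitPr: tq sq hc q'D pq {q0} => q1 q2 sq hc q'D pq.
  have pre : ~~ e k i -> q2 = [::].
    move=> eki; have : N.+1 < size (rcons q1 t).
      apply: (mn i k) => //; first by rewrite eq_sym.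
      - by rewrite emb_sym.
      - move=> u; rewrite mem_rcons inE => hu; apply: q'D.
        by rewrite mem_cat inE; case/orP: hu => ->; rewrite ?orbT.
      move: pq; rewrite rcons_cat cat_path rcons_cons /= => /and3P[p1 p2 _].
      by rewrite !rcons_path p1 p2 last_rcons.
    move: sq; rewrite size_cat size_rcons /= addnS => -[<-].
    by rewrite ltnS -[X in _ <= X]addn0 leq_add2l leqn0 size_eq0 => /eqP.
  have suf : ~~ e k j -> q1 = [::].
    move=> ekj; have : N.+1 < size (t :: q2).
      apply: (mn k j) => //.
      - move=> u hu; apply: q'D.
        by rewrite mem_cat hu orbT.
      move: pq; rewrite rcons_cat cat_path rcons_cons /= => /and3P[_ _ p3].
      by rewrite adjC tk.
    move: sq; rewrite size_cat /= addnS => -[<-].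
    by rewrite ltnS -[X in _ <= X]add0n leq_add2r leqn0 size_eq0 => /eqP.
  case eki: (e k i); case ekj: (e k j).
  - by rewrite eki ekj in nk.
  - move: pq; rewrite suf ?ekj //= => /andP[it _].
    apply: (@no_triangle _ hG (h i) t (h k)) => //.
    by rewrite (emb_adj hs).
  - move: pq; rewrite pre ?eki // rcons_cat cat_path /= => /and3P[_ _ /andP[tj _]].
    apply: (@no_triangle _ hG (h j) t (h k)) => //; first by rewrite adjC.
    by rewrite (emb_adj hs).
  - by move: sq; rewrite pre ?eki // suf ?ekj.
have anti (r : seq nat) : all (fun k => k < n) r ->
    {in r, forall k, [/\ k != i, k != j & ~~ (e k i && e k j)]} ->
    anticomplete q' (map h r).
  move=> /allP hr hk t u tq /mapP[k kr ->]; have [k1 k2 k3] := hk k kr; split.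
    by apply: contraNneq (Ds _ (q'D _ tq)) => ->; apply: emb_in; apply: hr.
  by apply: off => //; apply: hr.
have /andP[h3 h4] := far_pairsP hP hi hj ij eij.
have g3 : has_path3 n e i j -> odd (size q' + 2) -> size q' + 2 = 3.
  move=> {}h3; have [a ha /andP[_ /has_iota[b hb hab]]] := has_iota h3.
  have hall : all (fun k => k < n) [:: a; b] by rewrite /= ha hb.
  have := glue_odd hG hc (has_pathP (r := [:: a; b]) hi hj hall hab) q0 isT; apply.
  apply: anti => // k; move: hab; rewrite /= !inE !negb_or !andbT.
  case/and4P=> ia /and3P[nia nib _] /andP[eib _] /and4P[eab /andP[nab naj] eaj /andP[ebj nbj]].
  case/orP=> /eqP->; split=> //; rewrite 1?eq_sym //.
    by rewrite (negbTE eaj) andbF.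
  by rewrite emb_sym // (negbTE eib).
have g5 : has_path5 n e i j -> odd (size q' + 4) -> size q' + 4 = 3.
  case/has_iota=> a ha /andP[_ /has_iota[b hb /andP[_ /has_iota[c hc' /andP[_ /has_iota[d hd hab]]]]]].
  have hall : all (fun k => k < n) [:: a; b; c; d] by rewrite /= ha hb hc' hd.
  have := glue_odd hG hc (has_pathP (r := [:: a; b; c; d]) hi hj hall hab) q0 isT; apply.
  apply: anti => // k; move: hab; rewrite /= !inE !negb_or !andbT.
  case/and4P=> ia /and5P[nia nib nic nid _] /and4P[eib eic eid _].
  case/and4P=> eab /and4P[nab nac nad naj] /and3P[eac ead eaj].
  case/and4P=> ebc /and3P[nbc nbd nbj] /andP[ebd ebj] /and4P[ecd /andP[ncd ncj] ecj /andP[edj ndj]].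
  case/or4P=> /eqP->; split=> //; rewrite 1?eq_sym //.
  - by rewrite (negbTE eaj) andbF.
  - by rewrite (negbTE ebj) andbF.
  - by rewrite (negbTE ecj) andbF.
  - by rewrite emb_sym // (negbTE eid).
have g4 : has_path4 n e i j -> odd (size q' + 3) -> size q' + 3 = 3.
  move=> {}h4.
  have [a ha /andP[_ /has_iota[b hb /andP[_ /has_iota[c hc' hab]]]]] := has_iota h4.
  have hall : all (fun k => k < n) [:: a; b; c] by rewrite /= ha hb hc'.
  have := glue_odd hG hc (has_pathP (r := [:: a; b; c]) hi hj hall hab) q0 isT; apply.
  apply: anti => // k; move: hab; rewrite /= !inE !negb_or !andbT.
  case/and4P=> ia /and4P[nia nib nic _] /and3P[eib eic _].
  case/and4P=> eab /and3P[nab nac naj] /andP[eac eaj] /and4P[ebc /andP[nbc nbj] ebj /andP[ecj ncj]].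
  case/or3P=> /eqP->; split=> //; rewrite 1?eq_sym //.
  - by rewrite (negbTE eaj) andbF.
  - by rewrite (negbTE ebj) andbF.
  - by rewrite emb_sym // (negbTE eic).
have oq : odd (size q').
  apply: contraT => eq; move: (g4 h4); rewrite oddD (negbTE eq) sq => /(_ isT).
  by rewrite addn3.
by case/orP: h3 => [/g3|/g5]; rewrite oddD oq sq => /(_ isT); rewrite ?addn2 ?addn4.
Qed.

Lemma two_nbrs y i j : y \notin s -> i < n -> j < n -> i != j -> y -- h i -> y -- h j ->
  ~~ e i j /\ ~~ common n e i j.
Proof.
move=> ys hi hj ij yi yj; split.
  by apply/negP=> eij; apply: (@no_triangle _ hG y (h i) (h j)); rewrite ?(emb_adj hs) // adjC.
apply/negP=> /has_iota[k hk /andP[ik kj]].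
apply: (@no_square _ hG y (h i) (h k) (h j)); rewrite ?(emb_adj hs) ?emb_eq //.
  by apply: contraNneq ys => ->; apply: emb_in.
by rewrite adjC.
Qed.

(** By girth [y] is adjacent to no interior vertex of the path, each being within distance two of an
    end; so [y] and the path form a 7-hole. *)
Lemma no_path5 y i j : y \notin s -> i < n -> j < n -> i != j -> y -- h i -> y -- h j ->
  ~~ has_path5 n e i j.
Proof.
move=> ys hi hj ij yi yj; apply/negP.
case/has_iota=> a ha /andP[_ /has_iota[b hb /andP[_ /has_iota[c hc /andP[_ /has_iota[d hd]]]]]] h5.
have hall : all (fun k => k < n) [:: a; b; c; d] by rewrite /= ha hb hc hd.
have hp := has_pathP (r := [:: a; b; c; d]) hi hj hall h5.
have yh k : k < n -> (y == h k) = false.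
  by move=> hk; apply/negbTE; apply: contraNneq ys => ->; apply: emb_in.
have := odd_hole hG hp yi yj; rewrite /= !inE !yh //=.
move: h5; rewrite /= !inE !negb_or !andbT.
case/and4P=> ia /and5P[nia nib nic nid _] _.
case/and4P=> eab /and4P[nab nac nad naj] _ /and4P[ebc /and3P[nbc nbd nbj] _].
case/and4P=> ecd /andP[ncd ncj] _ /andP[edj ndj].
have comm k l t : t < n -> e k t -> e t l -> common n e k l.
  by move=> ht kt tl; apply/hasP; exists t; rewrite ?mem_iota ?kt.
have key k l : k < n -> l < n -> k != l -> y -- h k -> e k l || common n e k l -> ~~ y -- h l.
  move=> hk hl kl yk hkl; apply/negP=> yl.
  by have [/negbTE n1 /negbTE n2] := two_nbrs ys hk hl kl yk yl; rewrite n1 n2 in hkl.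
rewrite (key i a) ?ia // (key i b) ?(comm i b a) ?orbT //.
rewrite (key j d) // ?(key j c) //=.
- by move=> /(_ isT isT isT).
- by rewrite eq_sym.
- by rewrite (comm j c d) ?orbT // emb_sym.
- by rewrite eq_sym.
- by rewrite emb_sym // edj.
Qed.

(** With no triangles, the attachments of [D] lie in one edge, and [has_ext] enlarges it to a
    P3-cutset. *)
Lemma clique_cutset D w : has_ext n e -> 0 < n -> w \in D -> {in D, forall v, v \notin s} ->
  (forall v y, v \in D -> v -- y -> (y \in D) || (y \in s)) ->
  (forall i j, i < n -> j < n -> i != j -> touches D (h i) -> touches D (h j) -> e i j) ->
  exists p : seq G, P3_cutset p.
Proof.
move=> /allP hx n0 wD Ds cl hT.
have [i [j [hi hj eij sub]]] : exists i j, [/\ i < n, j < n, e i j &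
    forall l, l < n -> touches D (h l) -> (l == i) || (l == j)].
  case: (boolP (has (fun i => touches D (h i)) (iota 0 n))) => [/has_iota[i hi ti]|no].
    case: (boolP (has (fun j => (j != i) && touches D (h j)) (iota 0 n))).
      case/has_iota=> j hj /andP[ji tj]; exists i, j; split=> //.
        by apply: hT; rewrite // eq_sym.
      move=> l hl tl; apply: contraT; rewrite negb_or => /andP[li lj].
      case: (@no_triangle _ hG (h i) (h j) (h l)); rewrite (emb_adj hs) //; apply: hT => //.
      - by rewrite eq_sym.
      - by rewrite eq_sym.
    move=> no; have := hx i; rewrite mem_iota => /(_ hi) /andP[/has_iota[j hj eij] _].
    exists i, j; split=> // l hl tl; apply/orP; left; apply: contraNT no => li.
    by apply/hasP; exists l; rewrite ?mem_iota ?li.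
  have := hx 0; rewrite mem_iota => /(_ n0) /andP[/has_iota[j hj eij] _].
  exists 0, j; split=> // l hl tl; case/negP: no.
  by apply/hasP; exists l; rewrite ?mem_iota.
have := hx i; rewrite mem_iota => /(_ hi) /andP[_ /allP /(_ j)].
rewrite mem_iota eij => /(_ hj) /has_iota[k hk /andP[hc /has_iota[l hl lijk]]].
have nD v : v \in s -> v \notin D by apply: contraL => /Ds.
exists [:: h i; h j; h k]; apply: (@P3_cutsetI _ D (h i) (h j) (h k) (h l) w) => //.
- by apply: (@emb_chordless [:: i; j; k]); rewrite //= hi hj hk.
- by apply: nD; apply: emb_in.
- by move: lijk; rewrite !inE !emb_eq.
- by apply: nD; apply: emb_in.
- by apply: nD; apply: emb_in.
- by apply: nD; apply: emb_in.
move=> y /[dup] ty /touchesP[v vD]; rewrite adjC => vy.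
case/orP: (cl _ _ vD vy) => [->//|/emb_onto[t ht yt]]; subst y.
by rewrite !inE !emb_eq //; case/orP: (sub t ht ty) => ->; rewrite ?orbT.
Qed.

Lemma outside_nbr i k1 k2 : 2 < degree (h i) -> i < n -> k1 < n -> k2 < n ->
  (forall l, l < n -> e i l -> (l == k1) || (l == k2)) ->
  exists2 z, z \notin s & z -- h i.
Proof.
move=> hd hi h1 h2 hl; have [u [v [iu iv uv u1 v1]]] := degree_gt2 (h k1) hd.
have key t : h i -- t -> t != h k1 -> t != h k2 -> t \notin s.
  move=> it t1 t2; apply/negP=> /emb_onto[l ll tl]; subst t.
  move: it; rewrite (emb_adj hs) // => /(hl _ ll) /orP[] /eqP e1.
    by rewrite e1 eqxx in t1.
  by rewrite e1 eqxx in t2.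
case: (eqVneq u (h k2)) => [u2|u2]; last by exists u; [apply: key | rewrite adjC].
by exists v; [apply: key; rewrite // -u2 eq_sym | rewrite adjC].
Qed.

End Fix.

End Embed.

Lemma far_pairs_impl n e (P Q : nat -> nat -> bool) :
  (forall i j, P i j -> Q i j) -> far_pairs n e P -> far_pairs n e Q.
Proof.
move=> PQ /allP h; apply/allP=> i hi; apply/allP=> j hj.
by have /allP/(_ j hj) := h i hi; case: ifP => // _ /PQ.
Qed.

Section PairOf.

Let pair0 : pair5.
Proof. by exists [set ord0; ord_max]; rewrite cards2. Defined.

Definition pair_of i : pair5 :=
  insubd pair0 [set inord (kpair i).1; inord (kpair i).2].

Lemma kpair_lt i : ((kpair i).1 < 5) && ((kpair i).2 < 5) && ((kpair i).1 != (kpair i).2).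
Proof. by do 10?[case: i => [|i] //]; rewrite /kpair nth_default. Qed.

Lemma inord_eq a b : a < 5 -> b < 5 -> ((inord a : 'I_5) == inord b) = (a == b).
Proof. by move=> ha hb; rewrite -val_eqE /= !inordK. Qed.

Lemma val_pair_of i :
  val (pair_of i) = [set inord (kpair i).1; inord (kpair i).2].
Proof.
have /andP[/andP[i1 i2] ni] := kpair_lt i.
have h : #|[set inord (kpair i).1; inord (kpair i).2] : {set 'I_5}| == 2.
  by rewrite cards2 inord_eq // ni.
exact: (insubdK pair0 h).
Qed.

Lemma pair_of_adj i j : petersen_adj (pair_of i) (pair_of j) = kneser i j.
Proof.
have /andP[/andP[i1 i2] ni] := kpair_lt i; have /andP[/andP[j1 j2] nj] := kpair_lt j.
rewrite /petersen_adj !val_pair_of disjoints_subset subUset !sub1set !inE !negb_or.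
by rewrite !inord_eq // -andbA.
Qed.

Lemma card_pair5 : #|pair5| = 10.
Proof.
transitivity #|[set A : {set 'I_5} | #|A| == 2]|; last by rewrite card_draws card_ord.
by rewrite card_sig; apply: eq_card => A; rewrite !inE.
Qed.

End PairOf.

Lemma kneser_sym i j : kneser i j = kneser j i.
Proof.
rewrite /kneser (eq_sym (kpair j).1 (kpair i).1) (eq_sym (kpair j).1 (kpair i).2).
rewrite (eq_sym (kpair j).2 (kpair i).1) (eq_sym (kpair j).2 (kpair i).2).
by do 4!case: (_ == _).
Qed.

(** * From the Petersen graph minus a vertex to the whole graph *)

Section PetersenMinusVertex.

Variable G : sgraph.
Implicit Types (u v w x y z : G).

Hypothesis hG : pentagraph G.
Hypothesis hdeg : forall v, 2 < degree v.

Lemma isomorphic_petersen (s : seq G) : embeds 10 (kneser_del 10) s ->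
  (forall v, v \in s) -> isomorphic G petersen.
Proof.
move=> hs hv; pose f v : petersen := pair_of (index v s).
have il v : index v s < 10 by rewrite -(emb_size hs) index_mem.
have hf u v : petersen_adj (f u) (f v) = u -- v.
  rewrite pair_of_adj -[u in RHS](nth_index u (hv u)) -[v in RHS](nth_index u (hv v)).
  rewrite (emb_adj hs) // /kneser_del; have := il u; have := il v.
  by rewrite !ltn_neqAle => /andP[/negbTE-> _] /andP[/negbTE-> _]; rewrite !andbF andbT.
(* Vertices with the same image have the same neighbours, which girth five and degree at least two
   exclude. Bijectivity follows by counting. *)
exists f; last by move=> u v; apply: hf.
apply: inj_card_bij => [u v e|].
  have [a [b [ua ub ab _ _]]] := degree_gt2 u (hdeg u).
  apply/eqP; apply: contraT => uv; move/eqP: ab; case.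
  by apply: (@common_nbr _ hG u v) => //; rewrite -hf -e hf.
rewrite [#|petersen|]card_pair5 -(emb_size hs) -(card_uniqP (emb_uniq hs)).
exact: max_card.
Qed.

Hypothesis hP3 : ~ exists p : seq G, P3_cutset p.

Lemma outside_component n e (s : seq G) x0 z : embeds n e s -> 0 < n -> has_ext n e ->
  far_pairs n e (fun i j => (has_path3 n e i j || has_path5 n e i j) && has_path4 n e i j) ->
  z \notin s ->
  exists k l y, [/\ y \notin s, k < n /\ l < n, k != l, ~~ e k l &
    y -- nth x0 s k /\ y -- nth x0 s l].
Proof.
move=> hs n0 hx hP zs; apply: NNPP => no; apply: hP3.
have zs' : z \notin [set v in s] by rewrite inE.
have Ds : {in component [set v in s] z, forall w, w \notin s}.
  by move=> w /(component_sub zs'); rewrite inE.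
apply: (clique_cutset hG (x0 := x0) hs hx n0 (component_id [set v in s] z) Ds).
  move=> v y vD vy; case: (boolP (y \in s)) => ys; first by rewrite orbT.
  by rewrite (component_closed zs' vD vy) // inE.
move=> i j hi hj ij ti tj; apply: contraT => eij.
have nij : nth x0 s i != nth x0 s j by rewrite (emb_eq x0 hs).
have aij : ~~ nth x0 s i -- nth x0 s j by rewrite (emb_adj hs).
have [q [hq _ qD]] := conn_chordless (component_conn zs') ti tj nij aij.
have [k [l [y [yD kl e1 e2 e3]]]] :=
  linked_pair hG hs hP Ds hi hj ij eij qD (chordless_path hq).
by case: no; exists k, l, y; split=> //; apply: Ds.
Qed.

Lemma kneser_del_full m (s : seq G) x0 z : m \in [:: 2; 5; 8; 10] ->
  embeds 10 (kneser_del m) s -> z \notin s -> False.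
Proof.
move=> hm hs zs; have hk := kneser_paths hm.
have [|k [l [y [ys [hkn hln] kl ekl [yk yl]]]]] :=
  outside_component x0 hs isT (kneser_ext hm) _ zs.
  by apply: far_pairs_impl hk => i j /and3P[h -> _]; move: h; case: (has_path3 _ _ _ _) => //= ->.
have [_ /negbTE nc] := two_nbrs hG hs ys hkn hln kl yk yl.
have /negbTE np := no_path5 hG hs ys hkn hln kl yk yl.
by have /and3P[_ _] := far_pairsP hk hkn hln kl ekl; rewrite nc np.
Qed.

Lemma embeds_rcons m (s : seq G) y : embeds 9 kneser s -> y \notin s ->
  (forall x i, i < 9 -> y -- nth x s i = kneser_del m 9 i) ->
  m \in [:: 2; 5; 8; 10] -> embeds 10 (kneser_del m) (rcons s y).
Proof.
move=> hs ys hy hm; split.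
- by rewrite size_rcons (emb_size hs).
- by rewrite rcons_uniq ys (emb_uniq hs).
have sym i : kneser_del m i 9 = kneser_del m 9 i.
  rewrite /kneser_del kneser_sym; congr (_ && ~~ _).
  by case: (i == 9) (i == m) (9 == m) => [] [] [].
move=> x i j; rewrite (ltnS i) (ltnS j) !nth_rcons (emb_size hs) (leq_eqVlt i) (leq_eqVlt j).
case/orP=> [/eqP->|hi] /orP[/eqP->|hj]; rewrite ?ltnn ?eqxx ?hi ?hj.
- by rewrite adj_irr.
- exact: hy.
- by rewrite adjC hy // sym.
rewrite (emb_adj hs) // /kneser_del.
by rewrite (ltn_eqF hi) (ltn_eqF hj) /= andbT.
Qed.

(** Vertex 2 has only two neighbours in the copy, so something lies outside, and hence some [y] has
    two neighbours among 2, 5, 8. If it misses the third, [y] still has degree two in the enlarged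
    copy and needs a neighbour outside, against [kneser_del_full]. *)
Lemma kneser9_iso (s : seq G) : embeds 9 kneser s -> isomorphic G petersen.
Proof.
move=> hs; have [x0 _] : exists x0 : G, True.
  by case: s hs => [[]//|x0]; exists x0.
have [z zs _] := outside_nbr hs (x0 := x0) (i := 2) (k1 := 1) (k2 := 3) (hdeg _) isT isT isT
  (ltac:(by do 9?[case=> [|]//])).
have [|k [l [y [ys [hkn hln] kl ekl [yk yl]]]]] :=
  outside_component x0 hs isT kneser9_ext _ zs.
  by apply: far_pairs_impl kneser9_paths => i j /and3P[h -> _]; move: h; case: (has_path3 _ _ _ _) => //= ->.
have [_ /negbTE nc] := two_nbrs hG hs ys hkn hln kl yk yl.
have /and3P[_ _] := far_pairsP kneser9_paths hkn hln kl ekl.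
rewrite nc => /= /andP[hk hl].
(* Each remaining vertex is within distance two of each of 2, 5, 8, so [y] cannot be adjacent to
   it. *)
have chk : all (fun i => all (fun j => (i \in [:: 2; 5; 8]) || kneser i j ||
    common 9 kneser i j) [:: 2; 5; 8]) (iota 0 9) by vm_compute.
have off i : i < 9 -> i \notin [:: 2; 5; 8] -> (y -- nth x0 s i) = false.
  move=> hi i3; apply/negP=> yi.
  have ik : i != k by apply: contraNneq i3 => ->.
  have [/negbTE n1 /negbTE n2] := two_nbrs hG hs ys hi hkn ik yi yk.
  move/allP: chk => /(_ i); rewrite mem_iota => /(_ hi) /allP /(_ k hk).
  by rewrite n1 n2 (negbTE i3).
have [m [hm [m2 m5 m8]]] : exists m, m \in [:: 2; 5; 8; 10] /\
    [/\ (y -- nth x0 s 2) = (m != 2), (y -- nth x0 s 5) = (m != 5) &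
        (y -- nth x0 s 8) = (m != 8)].
  case e2: (y -- nth x0 s 2); case e5: (y -- nth x0 s 5); case e8: (y -- nth x0 s 8);
    [by exists 10 | by exists 8 | by exists 5 | | by exists 2 | | |]; exfalso;
    move: hk hl kl yk yl; rewrite !inE => /or3P[] /eqP-> /or3P[] /eqP->;
    by rewrite ?(e2, e5, e8).
have hs' : embeds 10 (kneser_del m) (rcons s y).
  apply: embeds_rcons => // x i hi.
  rewrite (set_nth_default x0) ?(emb_size hs) //.
  case: (boolP (i \in [:: 2; 5; 8])) => [|i3].
    by rewrite !inE => /or3P[] /eqP->; rewrite ?(m2, m5, m8) /kneser_del
      [kneser _ _](_ : _ = true) //= orbF eq_sym.
  rewrite off // /kneser_del; suff -> : kneser 9 i = false by [].
  by move: i3 hi; do 9?[case: i => [|i] //].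
case: (eqVneq m 10) => [m10|m10].
  subst m; apply: (isomorphic_petersen hs') => v.
  by apply: contraT => /(kneser_del_full x0 hm hs').
have [k1 [k2 [h1 h2 hk12]]] : exists k1 k2, [/\ k1 < 10, k2 < 10 &
    forall t, t < 10 -> kneser_del m 9 t -> (t == k1) || (t == k2)].
  move: hm m10; rewrite !inE => /or4P[] /eqP-> // _;
    [exists 5, 8 | exists 2, 8 | exists 2, 5]; split=> // t;
    by do 10?[case: t => [|t] //].
have [z' zs' _] := outside_nbr hs' (x0 := x0) (i := 9) (hdeg _) isT h1 h2 hk12.
by case: (kneser_del_full x0 hm hs' zs').
Qed.

Lemma petersen_minus_vertex_iso : petersen_minus_vertex G -> isomorphic G petersen.
Proof.
case=> c1 [c2 [c3 [c4 [c5 [n1 [n2 [n4 [n5 [hC [C1 C2 C4 C5] [a1 a2 a4 a5] [e14 e42 e25]]]]]]]]]].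
apply: (@kneser9_iso [:: c1; c2; c3; c4; c5; n1; n2; n4; n5]).
have E := hole5E hG hC.
have E1 := one_nbr hG hC C1 a1; have E2 := one_nbr2 hG hC C2 a2.
have E4 := one_nbr4 hG hC C4 a4; have E5 := one_nbr5 hG hC C5 a5.
have /andP[d12 n12] := class12_nadj hG hC C1 C2 a1 a2.
have hC4 := hole5_rot (hole5_rot (hole5_rot hC)).
have rot3 v : v \notin [:: c1; c2; c3; c4; c5] -> v \notin [:: c4; c5; c1; c2; c3].
  by move=> h; do 3!apply: notin_rot.
have /andP[d45 n45] := class12_nadj hG hC4 (rot3 _ C4) (rot3 _ C5) a4 a5.
have hC5 := hole5_rot hC4.
have /andP[d51 n51] := class12_nadj hG hC5 (notin_rot (rot3 _ C5)) (notin_rot (rot3 _ C1)) a5 a1.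
have d14 := adj_neq e14; have d42 := adj_neq e42; have d25 := adj_neq e25.
have [e41 e24 e52] : [/\ n4 -- n1, n2 -- n4 & n5 -- n2] by split; rewrite adjC.
have [n21 n54 n15] : [/\ ~~ n2 -- n1, ~~ n5 -- n4 & ~~ n1 -- n5] by split; rewrite adjC.
split=> //.
  rewrite /= !inE !(E, E1, E2, E4, E5) /= !negb_or d12 d14 d45 [n1 == n5]eq_sym d51.
  by rewrite [n2 == n4]eq_sym d42 d25.
move=> x i j; do 9?[case: i => [|i]] => //; do 9?[case: j => [|j]] => // _ _;
  by rewrite [LHS]/= ?(E, E1, E2, E4, E5, adj_irr, e14, e42, e25, e41, e24, e52,
    negbTE n12, negbTE n45, negbTE n51, negbTE n21, negbTE n54, negbTE n15).
Qed.

End PetersenMinusVertex.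

Theorem mainTheorem2 (G : sgraph) (hG : pentagraph G) :
  bipartite G \/
  isomorphic G petersen \/
  (exists v : G, degree v <= 2) \/
  ((exists p : seq G, P3_cutset p) \/
   (exists X : {set G}, strong_parity_star_cutset X)).
Proof.
case: (classic (exists v : G, degree v <= 2)) => [|hd]; first by right; right; left.
case: (classic (exists p : seq G, P3_cutset p)) => [|hP3].
  by right; right; right; left.
case: (classic (exists X : {set G}, strong_parity_star_cutset X)) => [|hS].
  by right; right; right; right.
have hdeg (v : G) : 2 < degree v by rewrite ltnNge; apply/negP=> h; apply: hd; exists v.
case: (classic (petersen_minus_vertex G)) => [h9|h9].
  by right; left; apply: petersen_minus_vertex_iso.
by left; apply: bipartite_of_no_cutset.
Qed.
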